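(* There exists $N\in\mathbb{N}$ such that for any finite symmetric set $S\subset\mathrm{SA}(2,\mathbb{Z})$ containing $1$ and generating a non-virtually solvable subgroup $\Gamma$ which does not have a global fixed point, there exist $a,b\in S^N$ such that the action of $\Gamma$ on $\mathbb{R}^2$, endowed with its Borel $\sigma$-algebra, is $(\{a,b\},1/4)$-non-amenable. In particular, the action of $\Gamma$ on $\mathbb{R}^2$ is uniformly non-amenable.
   Context: $\mathrm{SA}(2,\mathbb{Z})=\mathrm{SL}(2,\mathbb{Z})\ltimes\mathbb{Z}^2$, acting on $\mathbb{R}^2$ by affine transformations $gx=\theta(g)x+\tau(g)$, where $\theta(g)$ is the linear part and $\tau(g)$ the translation part. A global fixed point is a point of $\mathbb{R}^2$ fixed by every element of $\Gamma$. $S$ is symmetric if $S^{-1}=S$, and $S^N=\{s_1\cdots s_N : s_i\in S\}$. Let a group $G$ act measurably on $(X,\mathfrak{M})$. For finitely additive probability measures $\mu,\nu$ on $\mathfrak{M}$ put $\|\mu-\nu\|_{\mathrm{TV}}=\sup_{A\in\mathfrak{M}}|\mu(A)-\nu(A)|$, and let $g_*\mu$ be the pushforward of $\mu$ by $g$. For a finite subset $T\subset G$ and $\epsilon>0$, the action is $(T,\epsilon)$-non-amenable if $\sup_{g\in T}\|g_*\mu-\mu\|_{\mathrm{TV}}>\epsilon$ for every finitely additive probability measure $\mu$ on $\mathfrak{M}$. The action is uniformly non-amenable if there is $\epsilon>0$ such that it is $(T,\epsilon)$-non-amenable for every finite generating set $T$ of $G$. *)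

(* Defs.v *)
From HB Require Import structures.
From mathcomp Require Import all_boot all_order all_algebra.
From mathcomp Require Import all_classical all_reals all_analysis.

Set Implicit Arguments.
Unset Strict Implicit.
Unset Printing Implicit Defensive.

Import Order.TTheory GRing.Theory Num.Theory.
Import numFieldNormedType.Exports.

Local Open Scope classical_set_scope.
Local Open Scope ring_scope.

Section Groups.
Context {G : groupType}.
Implicit Types (S H K : set G) (N : nat).
Local Open Scope group_scope.

Definition subgroup H : Prop := group_closed [in H].

Definition generated S : set G := smallest subgroup S.

Definition symmetric_set S : Prop := [set g^-1 | g in S] = S.

Definition set_power S N : set G :=
  [set g | exists s : 'I_N -> G, (forall i, S (s i)) /\ g = \prod_(i < N) s i].

Definition derived_subgroup H : set G :=
  generated [set [~ x, y] | x in H & y in H].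

Definition solvable_subgroup H : Prop :=
  exists n, iter n derived_subgroup H = [set 1].

(* The index of H in K is the number of left cosets gH with g in K. *)
Definition finite_index H K : Prop :=
  finite_set [set [set g * h | h in H] | g in K].

Definition virtually_solvable K : Prop :=
  exists H : set G,
    [/\ subgroup H, H `<=` K, finite_index H K & solvable_subgroup H].

End Groups.

Section Actions.
Context {G : groupType} {d : measure_display} {X : measurableType d}.

Record measurable_action := MeasurableAction {
  act_fun :> G -> X -> X;
  act_fun1 : forall x, act_fun 1%g x = x;
  act_funM : forall g h x, act_fun (g * h)%g x = act_fun g (act_fun h x);
  act_fun_measurable : forall g, measurable_fun setT (act_fun g) }.

Definition has_global_fixed_point (act : measurable_action) (K : set G) : Prop :=
  exists x : X, forall g, K g -> act g x = x.

Context {R : realType}.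
Local Open Scope ereal_scope.

Definition tv_dist (mu nu : set X -> \bar R) : \bar R :=
  ereal_sup [set `|mu A - nu A| | A in (measurable : set (set X))].

(* A finitely additive probability measure is a content of total mass 1; the
   values of a content on nonmeasurable sets carry no information. *)
Definition nonamenable_for (act : measurable_action) (T : set G) (eps : R)
    : Prop :=
  forall mu : {content set X -> \bar R}, mu setT = 1 ->
    eps%:E < ereal_sup [set tv_dist (pushforward mu (act g)) mu | g in T].

(* The acting group is the subgroup K of G, through the restriction of act. *)
Definition uniformly_nonamenable (act : measurable_action) (K : set G) : Prop :=
  exists eps : R, (0 < eps)%R /\
    forall T : set G, finite_set T -> generated T = K ->
      nonamenable_for act T eps.

End Actions.
Arguments measurable_action G {d} X.
Arguments uniformly_nonamenable {G d X} R act K.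

Record SA2Z := MkSA2Z {
  SA2Z_val : 'M[int]_2 * 'cV[int]_2;
  SA2Z_det : \det SA2Z_val.1 == 1 }.

HB.instance Definition _ := [isSub for SA2Z_val].
HB.instance Definition _ := [Choice of SA2Z by <:].

Definition linear_part (g : SA2Z) : 'M[int]_2 := (SA2Z_val g).1.
Definition translation_part (g : SA2Z) : 'cV[int]_2 := (SA2Z_val g).2.

Section SA2Z_group.
Implicit Types g h k : SA2Z.

Fact SA2Z_one_det : \det ((1%:M, 0) : 'M[int]_2 * 'cV[int]_2).1 == 1.
Proof. by rewrite det1. Qed.

Definition SA2Z_one := MkSA2Z SA2Z_one_det.

Fact SA2Z_mul_det g h :
  \det (linear_part g *m linear_part h,
        linear_part g *m translation_part h + translation_part g).1 == 1.
Proof.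
by rewrite det_mulmx (eqP (SA2Z_det g)) (eqP (SA2Z_det h)) mulr1.
Qed.

Definition SA2Z_mul g h := MkSA2Z (SA2Z_mul_det g h).

Fact SA2Z_inv_det g :
  \det (invmx (linear_part g), - (invmx (linear_part g) *m translation_part g)).1
    == 1.
Proof. by rewrite det_inv (eqP (SA2Z_det g)) invr1. Qed.

Definition SA2Z_inv g := MkSA2Z (SA2Z_inv_det g).

Lemma SA2Z_unitmx g : linear_part g \in unitmx.
Proof. by rewrite unitmxE (eqP (SA2Z_det g)) unitr1. Qed.

Lemma SA2Z_eq g h : linear_part g = linear_part h ->
  translation_part g = translation_part h -> g = h.
Proof.
case: g h => [[A v] Ag] [[B w] Bh]; rewrite /linear_part /translation_part/=.
by move=> AB vw; apply: val_inj => /=; rewrite AB vw.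
Qed.

Lemma linear_partM g h :
  linear_part (SA2Z_mul g h) = linear_part g *m linear_part h.
Proof. by []. Qed.

Lemma translation_partM g h : translation_part (SA2Z_mul g h) =
  linear_part g *m translation_part h + translation_part g.
Proof. by []. Qed.

Fact SA2Z_mulA : associative SA2Z_mul.
Proof.
move=> g h k; apply: SA2Z_eq; rewrite !(linear_partM, translation_partM).
  by rewrite mulmxA.
by rewrite mulmxDr mulmxA addrA.
Qed.

Fact SA2Z_mul1g : left_id SA2Z_one SA2Z_mul.
Proof.
move=> g; apply: SA2Z_eq; rewrite ?(linear_partM, translation_partM).
  exact: mul1mx.
by rewrite [X in _ + X](_ : _ = 0)// addr0; exact: mul1mx.
Qed.

Fact SA2Z_mulg1 : right_id SA2Z_one SA2Z_mul.
Proof.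
move=> g; apply: SA2Z_eq; rewrite ?(linear_partM, translation_partM).
  exact: mulmx1.
by rewrite [X in _ *m X](_ : _ = 0)// mulmx0 add0r.
Qed.

Fact SA2Z_mulVg : left_inverse SA2Z_one SA2Z_inv SA2Z_mul.
Proof.
move=> g; apply: SA2Z_eq; rewrite ?(linear_partM, translation_partM).
  exact: mulVmx (SA2Z_unitmx g).
exact: subrr.
Qed.

Fact SA2Z_mulgV : right_inverse SA2Z_one SA2Z_inv SA2Z_mul.
Proof.
move=> g; apply: SA2Z_eq; rewrite ?(linear_partM, translation_partM).
  exact: mulmxV (SA2Z_unitmx g).
by rewrite /translation_part/= mulmxN mulKVmx ?SA2Z_unitmx// addNr.
Qed.

HB.instance Definition _ := isGroup.Build SA2Z
  SA2Z_mulA SA2Z_mul1g SA2Z_mulg1 SA2Z_mulVg SA2Z_mulgV.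

End SA2Z_group.

(* R^2 with its Borel sigma-algebra. *)
Definition plane (R : realType) := g_sigma_algebraType (@open 'cV[R]_2).

Section affine_action.
Context (R : realType).

Definition affine_map (g : SA2Z) (x : 'cV[R]_2) : 'cV[R]_2 :=
  map_mx intr (linear_part g) *m x + map_mx intr (translation_part g).

Lemma affine_map1 (x : plane R) : affine_map 1%g x = x.
Proof. by rewrite /affine_map map_mx1 mul1mx map_mx0 addr0. Qed.

Lemma affine_mapM g h (x : plane R) :
  affine_map (g * h)%g x = affine_map g (affine_map h x).
Proof.
rewrite /affine_map linear_partM translation_partM.
by rewrite map_mxM map_mxD map_mxM mulmxDr mulmxA addrA.
Qed.

Lemma continuous_affine_map g : continuous (affine_map g).
Proof.
have cij i j : continuous (fun x : 'cV[R]_2 => affine_map g x i j).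
  pose a k : R := (linear_part g i k)%:~R.
  pose b : R := (translation_part g i j)%:~R.
  rewrite (_ : (fun x => _) =
      (fun x : 'cV[R]_2 => (\sum_(k < 2) a k * x k j) + b)); last first.
    apply/funext => x; rewrite !mxE; congr (_ + _).
    by apply: eq_bigr => k _; rewrite mxE.
  move=> x; apply: (@continuousD _ R^o); last exact: cst_continuous.
  apply: (cvg_big (@add_continuous R^o)) => [|k _].
    exact: (@nbhs_filter 'cV[R]_2 x).
  apply: (@continuousM _ _ (cst (a k))); first exact: cst_continuous.
  exact: coord_continuous.
move=> x A /= [P Px PA]; rewrite nbhs_simpl/=.
have FF := @nbhs_filter 'cV[R]_2 x.
have : \forall y \near x, forall i j, P i j (affine_map g y i j).
  apply: (@filter_forall _ _ _ _ FF) => i.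
  apply: (@filter_forall _ _ _ _ FF) => j.
  exact: (cij i j x _ (Px i j)).
by apply: (@filterS _ _ FF) => y Py; exact: PA.
Qed.

Lemma measurable_affine_map g :
  measurable_fun setT (affine_map g : plane R -> plane R).
Proof.
apply: (@measurability _ _ (plane R) (plane R) setT _ (@open 'cV[R]_2)) => //.
move=> _ [B oB <-]; rewrite setTI; apply: sub_sigma_algebra.
by apply: (open_comp _ oB) => x _; exact: continuous_affine_map.
Qed.

Definition affine_action : measurable_action SA2Z (plane R) :=
  MeasurableAction affine_map1 affine_mapM measurable_affine_map.

End affine_action.

(* Main.v *)
Require Import Defs.
From HB Require Import structures.
From mathcomp Require Import all_boot all_order all_algebra.
From mathcomp Require Import all_classical all_reals all_analysis.
From mathcomp Require Import measurable_realfun.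
From mathcomp Require Import ring lra zify.

Set Implicit Arguments.
Unset Strict Implicit.
Unset Printing Implicit Defensive.

Import Order.TTheory GRing.Theory Num.Theory.
Import numFieldNormedType.Exports.

Local Open Scope classical_set_scope.
Local Open Scope ring_scope.

(** Let [G] be the group generated by [S].

    The linear parts.  If two matrices of SL(2,Z) have trace of absolute value
    at most 2 and their commutator has trace at most 2, then they commute
    ([commutator_trace_commute]).  So either some [h] in [S^4] has a
    hyperbolic linear part [A], or the linear parts of [G] commute and [G] is
    metabelian.  The elements whose linear part conjugates [A] to itself or to
    its inverse form a solvable group, which therefore does not contain [G], and
    neither does the stabilizer of the fixed point [p] of [h].  Combining two
    elements of [S] that escape these two subgroups gives one element [s] of
    [S^2] that escapes both ([exists_transverse]).  The two elements of the theorem are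
    [a = h^10] and its conjugate [b = s h^10 s^-1].

    Uniformity.  Let [l] and [m = 1/l] be the eigenvalues of [A], and take for
    coordinates of the plane the two affine functions [x], [y], vanishing at
    [p], that [h] multiplies by [l] and [m]; the coordinates adapted to [b] are
    [x], [y] composed with [s^-1].  After rescaling, the change of coordinates is
      [x' = x + y + e],  [y' = x + chi y + f],  [(e, f) <> (0, 0)],
    where [chi = M / (M - D)] with [D = (tr A)^2 - 4 = (l - m)^2] and
    [M = tr (A (s A s^-1)) - 2].  Since [M] and [D] are integers, and [M] is
    neither [0] nor [D] (this uses that [D] is not a square), [|chi|] lies
    between [1/q] and [q] for [q = 1 + D], which is at most [l^2].  Hence the
    fixed power [l^10 >= 64 q^2] dominates all the geometric constants, while
    the position [(e, f)] of the second fixed point only enters through its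
    size [E = max(|e|, |f|)].

    The measure.  Suppose that a finitely additive probability is moved by at
    most 1/4 by [a] and by [b].  Under [a], a point outside a small square around
    [p] is thrown into a narrow cone around the expanding direction by [a] or
    into one around the contracting direction by [a^-1]; so the union [K] of the
    square and the two cones has measure at least [1 - 2/4] ([mass_core]).  But,
    seen from [b], the square lies at distance about [E] from the fixed point
    of [b] and the cones lie far from the axes of [b], so [K] is contained in a
    difference [C \ b C] for a set [C] with [b C] inside [C], or in the same for
    [b^-1]; hence [K] has measure at most 1/4 ([mass_wandering]), a
    contradiction.

    The uniform non-amenability of the second half follows by applying the
    first half to the symmetrization of a generating set [T]: if every element
    of [T] moves the measure by at most [eps], then a word of length [N] moves it
    by at most [N eps]. *)

(** * Traceless integer matrices *)

Lemma negsemidef_form_le0 (F : realDomainType) (D1 I D2 x y : F) :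
  D1 <= 0 -> D2 <= 0 -> I ^+ 2 <= D1 * D2 ->
  D1 * x ^+ 2 - 2 * I * x * y + D2 * y ^+ 2 <= 0.
Proof.
move=> D1le0 D2le0 ID; have [D1_0|D1_neq0] := eqVneq D1 0.
  have /eqP : I ^+ 2 = 0.
    by apply: le_anti; rewrite sqr_ge0 andbT; move: ID; rewrite D1_0 mul0r.
  rewrite sqrf_eq0 => /eqP ->; rewrite D1_0.
  have := mulr_le0_ge0 D2le0 (sqr_ge0 y); lra.
have D1lt0 : D1 < 0 by rewrite lt_neqAle D1_neq0.
rewrite -(nmulr_rge0 _ D1lt0).
have -> : D1 * (D1 * x ^+ 2 - 2 * I * x * y + D2 * y ^+ 2) =
    (D1 * x - I * y) ^+ 2 + (D1 * D2 - I ^+ 2) * y ^+ 2 by ring.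
by rewrite addr_ge0 ?sqr_ge0// mulr_ge0 ?sqr_ge0 ?subr_ge0.
Qed.

(** On traceless 2x2 matrices [-det] is a quadratic form of signature (2, 1).
    Up to a common factor, [D1] and [D2] are its values at the traceless parts
    of (a b; c d) and (e f; g h), and [I] is their inner product.  The
    commutator of the two matrices is orthogonal to both traceless parts, and
    the last hypothesis says that the form is nonpositive on it, which amounts
    to [I^2 <= D1 D2].  So the span of the two parts is negative semidefinite,
    and this forces each entry of the commutator to vanish: up to a positive
    factor and a nonpositive term, its square is a value of the form with
    matrix (D1 -I; -I D2). *)
Lemma nonhyperbolic_commute (F : realDomainType) (a b c d e f g h : F) :
  a * d - b * c = 1 -> e * h - f * g = 1 ->
  (a + d) ^+ 2 <= 4 -> (e + h) ^+ 2 <= 4 ->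
  (b * g - f * c) ^+ 2 +
    ((a - d) * f - b * (e - h)) * (c * (e - h) - (a - d) * g) <= 0 ->
  [/\ b * g = f * c, (a - d) * f = b * (e - h) & c * (e - h) = (a - d) * g].
Proof.
move=> ad eh t1 t2 E.
set p := a - d in E *; set p' := e - h in E *.
pose D1 := p ^+ 2 + 4 * b * c; pose D2 := p' ^+ 2 + 4 * f * g.
pose I := p * p' + 2 * b * g + 2 * c * f.
have D1le0 : D1 <= 0.
  rewrite (_ : D1 = (a + d) ^+ 2 - 4 * (a * d - b * c)); last first.
    by rewrite /D1 /p; ring.
  by rewrite ad mulr1 subr_le0.
have D2le0 : D2 <= 0.
  rewrite (_ : D2 = (e + h) ^+ 2 - 4 * (e * h - f * g)); last first.
    by rewrite /D2 /p'; ring.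
  by rewrite eh mulr1 subr_le0.
have ID : I ^+ 2 <= D1 * D2.
  rewrite -subr_le0 (_ : _ - _ =
    4 * ((b * g - f * c) ^+ 2 + (p * f - b * p') * (c * p' - p * g))).
    by rewrite pmulr_rle0.
  by rewrite /I /D1 /D2; ring.
have form x y := negsemidef_form_le0 x y D1le0 D2le0 ID.
have sq0 (x : F) : x ^+ 2 <= 0 -> x = 0.
  move=> x0; apply/eqP; rewrite -sqrf_eq0; apply/eqP/le_anti.
  by rewrite x0 sqr_ge0.
split; apply/eqP; rewrite -subr_eq0; apply/eqP/sq0.
- have := form p' p.
  rewrite -(@pmulr_rle0 _ 4 ((b * g - f * c) ^+ 2)) //.
  have -> : 4 * (b * g - f * c) ^+ 2 =
    (D1 * p' ^+ 2 - 2 * I * p' * p + D2 * p ^+ 2) + (I ^+ 2 - D1 * D2).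
    by rewrite /I /D1 /D2; ring.
  by move: ID; lra.
- rewrite (_ : _ ^+ 2 = D1 * f ^+ 2 - 2 * I * f * b + D2 * b ^+ 2)//.
  by rewrite /I /D1 /D2; ring.
- rewrite (_ : _ ^+ 2 = D1 * g ^+ 2 - 2 * I * g * c + D2 * c ^+ 2)//.
  by rewrite /I /D1 /D2; ring.
Qed.

(** For [|t| >= 3], [t^2 - 4] lies strictly between [(|t| - 1)^2] and [t^2], so
    it is not a square: the eigenvalues of a hyperbolic integer matrix are
    irrational. *)
Lemma trace_discriminant_nonsquare (t x y : int) :
  4 < t ^+ 2 -> x ^+ 2 = (t ^+ 2 - 4) * y ^+ 2 -> y = 0.
Proof.
move=> t4 xy; apply/eqP; apply: contraT => y0.
have /dvdzP[k xk] : (y %| x)%Z.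
  rewrite dvdzE -(@dvdn_pexp2r _ _ 2)// -!abszX xy abszM abszX.
  exact: dvdn_mull.
have : k ^+ 2 = t ^+ 2 - 4.
  by apply: (mulIf (expf_neq0 2 y0)); rewrite -xy xk exprMn.
rewrite -(real_normK (num_real k)) -(real_normK (num_real t)) in t4 *.
move: `|k| `|t| (normr_ge0 k) (normr_ge0 t) t4 => {y0 xk xy} k' t' k'0 t'0 t4 kt.
have t'2 : 2 < t' by nia.
have kt1 : k' < t' by nia.
have kt2 : t' - 1 < k' by nia.
lia.
Qed.

(** The unknown is the traceless matrix (x/2 y; z -x/2): it has determinant zero
    and is orthogonal to the traceless part (p/2 b; c -p/2) of a hyperbolic
    matrix.  The orthogonal of that part is a hyperbolic plane whose isotropic
    lines are irrational, because the discriminant [t^2 - 4] is not a square. *)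
Lemma isotropic_orthogonal_eq0 (t p b c x y z : int) :
  4 < t ^+ 2 -> p ^+ 2 + 4 * b * c = t ^+ 2 - 4 ->
  x ^+ 2 + 4 * y * z = 0 -> p * x + 2 * b * z + 2 * c * y = 0 ->
  [/\ x = 0, y = 0 & z = 0].
Proof.
move=> t4 D isot orth.
have b0 : b != 0.
  apply: contraPneq D => ->.
  rewrite mulr0 mul0r addr0 -[RHS]mulr1 -[in RHS](expr1n int 2).
  by move=> /(trace_discriminant_nonsquare t4).
have y0 : y = 0.
  apply: (@trace_discriminant_nonsquare t (b * x - p * y)) => //.
  rewrite -D; apply/eqP; rewrite -subr_eq0; apply/eqP.
  have -> : (b * x - p * y) ^+ 2 - (p ^+ 2 + 4 * b * c) * y ^+ 2 =
    b ^+ 2 * (x ^+ 2 + 4 * y * z) - 2 * b * y * (p * x + 2 * b * z + 2 * c * y).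
    by ring.
  by rewrite isot orth !mulr0 subr0.
have x0 : x = 0.
  by move/eqP: isot; rewrite y0 mulr0 mul0r addr0 sqrf_eq0 => /eqP.
split=> //; move/eqP: orth; rewrite x0 y0 !mulr0 add0r addr0 !mulf_eq0.
by rewrite (negbTE b0)/= => /eqP.
Qed.

(** * Two by two matrices *)

Section Matrix2.
Context {F : comUnitRingType}.
Implicit Types A B : 'M[F]_2.

Lemma forall_ord2 (P : 'I_2 -> Prop) : P 0 -> P 1 -> forall i, P i.
Proof.
move=> P0 P1 [[|[|//]] i2].
  by rewrite (_ : Ordinal i2 = 0)//; exact: val_inj.
by rewrite (_ : Ordinal i2 = 1)//; exact: val_inj.
Qed.

Lemma mx2P A B : A 0 0 = B 0 0 -> A 0 1 = B 0 1 -> A 1 0 = B 1 0 ->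
  A 1 1 = B 1 1 -> A = B.
Proof. by move=> ? ? ? ?; apply/matrixP; do 2![apply: forall_ord2]. Qed.

Lemma mulmx2E n (A : 'M[F]_2) (B : 'M[F]_(2, n)) i j :
  (A *m B) i j = A i 0 * B 0 j + A i 1 * B 1 j.
Proof.
rewrite mxE !big_ord_recl big_ord0 addr0.
by rewrite (_ : lift ord0 ord0 = 1)//; exact: val_inj.
Qed.

Lemma mxtrace2 A : \tr A = A 0 0 + A 1 1.
Proof.
rewrite /mxtrace !big_ord_recl big_ord0 addr0.
by rewrite (_ : lift ord0 ord0 = 1)//; exact: val_inj.
Qed.

Lemma det2E A : \det A = A 0 0 * A 1 1 - A 0 1 * A 1 0.
Proof.
rewrite (expand_det_row _ 0) !big_ord_recl big_ord0 addr0 /cofactor !det_mx11.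
rewrite !mxE/= expr0 expr1 mul1r mulN1r mulrN.
by congr (_ * A _ _ - A _ _ * A _ _); exact: val_inj.
Qed.

Lemma scalar_mx2E (x : F) (M := x%:M : 'M[F]_2) :
  (M 0 0 = x) * (M 0 1 = 0) * (M 1 0 = 0) * (M 1 1 = x).
Proof. by rewrite /M !mxE/= mulr1n mulr0n. Qed.

(** Cayley-Hamilton. *)
Lemma invmx2 A : \det A = 1 -> invmx A = (\tr A)%:M - A.
Proof.
move=> detA; have uA : A \in unitmx by rewrite unitmxE detA unitr1.
apply: (can_inj (mulKmx uA)); rewrite mulmxV//.
move: detA; rewrite det2E => detA.
by apply: mx2P; rewrite mulmx2E [X in _ = _ * X + _]mxE [X in _ = _ + _ * X]mxE
  ?[X in _ = _ * (_ + X) + _]mxE ?[X in _ = _ + _ * (_ + X)]mxE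
  !scalar_mx2E mxtrace2 -?detA; ring.
Qed.

Lemma invmx2E A : \det A = 1 -> (invmx A 0 0 = A 1 1) * (invmx A 0 1 = - A 0 1) *
  (invmx A 1 0 = - A 1 0) * (invmx A 1 1 = A 0 0).
Proof.
move=> /invmx2 ->; rewrite mxtrace2.
by do !split; rewrite mxE [X in _ + X]mxE scalar_mx2E ?add0r ?addrK// addrC addKr.
Qed.

End Matrix2.

(** [tr [A, B] - 2 = - det (A B - B A)], the form of [nonhyperbolic_commute] on
    the commutator. *)
Lemma commutator_trace_commute (A B : 'M[int]_2) : \det A = 1 -> \det B = 1 ->
  \tr A ^+ 2 <= 4 -> \tr B ^+ 2 <= 4 ->
  \tr (A *m B *m invmx A *m invmx B) <= 2 -> A *m B = B *m A.
Proof.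
move=> dA dB; rewrite !mxtrace2 !mulmx2E !(invmx2E dA) !(invmx2E dB).
move: dA dB; rewrite !det2E => dA dB tA tB tAB.
have [] := nonhyperbolic_commute dA dB tA tB.
  suff E : forall a b c d e f g h : int,
      (b * g - f * c) ^+ 2 +
        ((a - d) * f - b * (e - h)) * (c * (e - h) - (a - d) * g) =
      ((a * e + b * g) * d + (a * f + b * h) * - c) * h +
        ((a * e + b * g) * - b + (a * f + b * h) * a) * - g +
      (((c * e + d * g) * d + (c * f + d * h) * - c) * - f +
        ((c * e + d * g) * - b + (c * f + d * h) * a) * e) -
      2 * (a * d - b * c) * (e * h - f * g).
    by rewrite E dA dB !mulr1 subr_le0.
  by move=> *; ring.
by move=> ? ? ?; apply: mx2P; rewrite !mulmx2E; lia.
Qed.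

(** The difference (resp. the sum) of the traceless parts of the two matrices is
    isotropic and orthogonal to the traceless part of the first one exactly when
    the trace of the product is the one obtained for equal (resp. inverse)
    matrices. *)
Lemma conjugate_trace_scalar (a b c d e f g h : int) :
  a * d - b * c = 1 -> e * h - f * g = 1 -> e + h = a + d ->
  4 < (a + d) ^+ 2 ->
  (a * e + b * g + (c * f + d * h) = 2 ->
    [/\ e = d, f = - b, g = - c & h = a]) /\
  (a * e + b * g + (c * f + d * h) = (a + d) ^+ 2 - 2 ->
    [/\ e = a, f = b, g = c & h = d]).
Proof.
move=> dA dB tBA t4.
have DA : (a - d) ^+ 2 + 4 * b * c = (a + d) ^+ 2 - 4 by move: dA; lia.
have DB : (e - h) ^+ 2 + 4 * f * g = (a + d) ^+ 2 - 4.
  by rewrite -tBA; move: dB; lia.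
have tt : (e + h) * (a + d) = (a + d) ^+ 2 by rewrite tBA.
split=> tAB.
- have [||x y z] := @isotropic_orthogonal_eq0 _ (a - d) b c
    ((a - d) + (e - h)) (b + f) (c + g) t4 DA; [lia|lia|split; lia].
- have [||x y z] := @isotropic_orthogonal_eq0 _ (a - d) b c
    ((a - d) - (e - h)) (b - f) (c - g) t4 DA; [lia|lia|split; lia].
Qed.

Lemma conjugate_trace_dichotomy (A B : 'M[int]_2) :
  \det A = 1 -> \det B = 1 -> \tr B = \tr A -> 4 < \tr A ^+ 2 ->
  (\tr (A *m B) = 2 -> B = invmx A) /\
  (\tr (A *m B) = \tr A ^+ 2 - 2 -> B = A).
Proof.
move=> dA dB; rewrite !mxtrace2 !mulmx2E => tBA t4.
have A'E := invmx2E dA; rewrite !det2E in dA dB.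
have [AB2 ABt] := conjugate_trace_scalar dA dB tBA t4.
by split=> [/AB2|/ABt] [? ? ? ?]; apply: mx2P; rewrite ?A'E.
Qed.

(** * Generated subgroups and powers of a set *)

Section Subgroups.
Context {G : groupType}.
Implicit Types (S H K : set G) (x y : G).
Local Open Scope group_scope.

Lemma subgroupP H :
  subgroup H <-> H 1 /\ (forall x y, H x -> H y -> H (x * y^-1)).
Proof.
split=> [[H1 HV]|[H1 HV]].
  split=> [|x y Hx Hy]; first by move: H1; rewrite !inE.
  by have := HV x y; rewrite !inE; apply.
by split=> [|x y]; rewrite !inE//; exact: HV.
Qed.

Lemma generated_subgroup S : subgroup (generated S).
Proof.
apply/subgroupP; split=> [H [/subgroupP[H1 _] _]//|x y Sx Sy H SH].
by have [/subgroupP[_ HV] _] := SH; exact: HV (Sx H SH) (Sy H SH).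
Qed.

Lemma sub_generated S : S `<=` generated S.
Proof. exact: sub_gen_smallest. Qed.

Lemma generated_sub S H : subgroup H -> S `<=` H -> generated S `<=` H.
Proof. exact: smallest_sub. Qed.

Section Closure.
Variables (H : set G) (sgH : subgroup H).

Lemma subgroup1 : H 1. Proof. by case/subgroupP: sgH. Qed.

Lemma subgroupV x : H x -> H x^-1.
Proof.
by case/subgroupP: sgH => H1 HV Hx; rewrite -(mul1g x^-1); exact: HV.
Qed.

Lemma subgroupM x y : H x -> H y -> H (x * y).
Proof.
case/subgroupP: (sgH) => H1 HV Hx Hy.
by rewrite -(invgK y); apply: HV => //; exact: subgroupV.
Qed.

End Closure.

Lemma generated1 : generated (set1 (1 : G)) = set1 1.
Proof.
apply/seteqP; split; last exact: sub_generated.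
apply: generated_sub => //; apply/subgroupP; split=> // x y -> ->.
by rewrite invg1 mulg1.
Qed.

Lemma finite_index_refl H : subgroup H -> finite_index H H.
Proof.
move=> sgH; apply: (@sub_finite_set _ _ [set H]); last exact: finite_set1.
move=> _ [g Hg <-]; apply/seteqP; split=> [_ [h Hh <-]|h Hh].
  exact: (subgroupM sgH).
exists (g^-1 * h); last by rewrite mulVKg.
by apply: (subgroupM sgH) => //; exact: (subgroupV sgH).
Qed.

Lemma solvable_virtually_solvable H :
  subgroup H -> solvable_subgroup H -> virtually_solvable H.
Proof. by move=> sgH solH; exists H; split=> //; exact: (finite_index_refl sgH). Qed.

Lemma set_power0 S : set_power S 0 1.
Proof. by exists (fun=> 1); rewrite big_ord0; split=> // -[]. Qed.

Lemma set_powerS S n g :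
  set_power S n.+1 g <-> exists x y, [/\ set_power S n x, S y & g = x * y].
Proof.
split=> [[s [Ss ->]]|[x [y [[s [Ss ->]] Sy ->]]]].
  exists (\prod_(i < n) s (widen_ord (leqnSn n) i)), (s ord_max).
  split=> //; last by rewrite big_ord_recr.
  by exists (fun i => s (widen_ord (leqnSn n) i)).
exists (fun i => if unlift ord_max i is Some j then s j else y); split.
  by move=> i; case: unliftP.
rewrite big_ord_recr/= unlift_none; congr (_ * _); apply: eq_bigr => i _.
rewrite (_ : widen_ord _ i = lift ord_max i) ?liftK//.
by apply: val_inj; rewrite /= /bump leqNgt ltn_ord.
Qed.

Lemma set_powerM S m n x y :
  set_power S m x -> set_power S n y -> set_power S (m + n) (x * y).
Proof.
move=> Sx; elim: n y => [y [s [_ ->]]|n IH y].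
  by rewrite big_ord0 mulg1 addn0.
move=> /set_powerS[y1 [y2 [/IH Sy1 Sy2 ->]]]; rewrite addnS; apply/set_powerS.
by exists (x * y1), y2; rewrite mulgA.
Qed.

Lemma set_power1 S x : S x -> set_power S 1 x.
Proof.
move=> Sx; apply/set_powerS; exists 1, x; rewrite mul1g.
by split=> //; exact: set_power0.
Qed.

Lemma set_powerX S m n x : set_power S m x -> set_power S (m * n) (x ^+ n).
Proof.
move=> Sx; elim: n => [|n IH]; first by rewrite muln0 expg0; exact: set_power0.
by rewrite mulnS expgS; exact: set_powerM.
Qed.

Lemma leq_set_power S m n : S 1 -> (m <= n)%N -> set_power S m `<=` set_power S n.
Proof.
move=> S1 /subnKC <- x Sx; rewrite -(mulg1 x); apply: set_powerM => //.
by have := set_powerX (n - m)%N (set_power1 S1); rewrite mul1n expg1n.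
Qed.

Lemma symmetric_setV S x : symmetric_set S -> S x -> S x^-1.
Proof. by move=> symS Sx; rewrite -symS; exists x. Qed.

Lemma set_powerV S n x :
  symmetric_set S -> set_power S n x -> set_power S n x^-1.
Proof.
move=> symS; elim: n x => [x [s [_ ->]]|n IH x].
  by rewrite big_ord0 invg1; exact: set_power0.
move=> /set_powerS[y [z [/IH Sy Sz ->]]]; rewrite invgM -addn1 addnC.
by apply: set_powerM => //; apply: set_power1; exact: symmetric_setV.
Qed.

End Subgroups.

(** * Hyperbolic and transverse elements *)

Lemma hyperbolic_offdiagonal (a b c d : int) :
  a * d - b * c = 1 -> 4 < (a + d) ^+ 2 -> b != 0 /\ c != 0.
Proof.
move=> detA trA; suff bc0 : b * c != 0.
  by split; apply: contraNneq bc0 => ->; rewrite ?mul0r ?mulr0.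
apply/eqP => bc0.
have : (a - d) ^+ 2 = ((a + d) ^+ 2 - 4) * 1 ^+ 2.
  by rewrite expr1n mulr1; move: detA; rewrite bc0 subr0; lia.
by move=> /(trace_discriminant_nonsquare trA).
Qed.

(** The traceless part of a matrix commuting with [A] is proportional to that of
    [A]. *)
Lemma hyperbolic_centralizer_commute (A X Y : 'M[int]_2) :
  \det A = 1 -> 4 < \tr A ^+ 2 ->
  X *m A = A *m X -> Y *m A = A *m Y -> X *m Y = Y *m X.
Proof.
rewrite det2E mxtrace2 => dA tA.
have [b0 c0] := hyperbolic_offdiagonal dA tA.
have par Z : Z *m A = A *m Z -> [/\ Z 0 1 * A 1 0 = A 0 1 * Z 1 0,
    A 0 1 * (Z 0 0 - Z 1 1) = Z 0 1 * (A 0 0 - A 1 1) &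
    A 1 0 * (Z 0 0 - Z 1 1) = Z 1 0 * (A 0 0 - A 1 1)].
  move=> /matrixP ZA; move: (ZA 0 0) (ZA 0 1) (ZA 1 0); rewrite !mulmx2E.
  by move=> E1 E2 E3; split; lra.
move=> /par[X1 X2 X3] /par[Y1 Y2 Y3].
have XY1 : X 0 1 * Y 1 0 = Y 0 1 * X 1 0.
  by apply: (mulfI b0); rewrite mulrCA -Y1 mulrCA X1 mulrCA.
have XY2 : Y 0 1 * (X 0 0 - X 1 1) = X 0 1 * (Y 0 0 - Y 1 1).
  by apply: (mulfI b0); rewrite mulrCA X2 [RHS]mulrCA Y2; ring.
have XY3 : Y 1 0 * (X 0 0 - X 1 1) = X 1 0 * (Y 0 0 - Y 1 1).
  by apply: (mulfI c0); rewrite mulrCA X3 [RHS]mulrCA Y3; ring.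
by apply: mx2P; rewrite !mulmx2E; lra.
Qed.

Lemma linear_partV (g : SA2Z) : linear_part g^-1%g = invmx (linear_part g).
Proof. by []. Qed.

Lemma linear_part_det (g : SA2Z) : \det (linear_part g) = 1.
Proof. exact/eqP/SA2Z_det. Qed.

Lemma commg_eq1 (G : groupType) (x y : G) : (x * y = y * x)%g -> [~ x, y]%g = 1%g.
Proof. by move=> xy; apply: (mulgI (y * x)%g); rewrite -commgC mulg1. Qed.

Lemma linear_part_commg (x y : SA2Z) :
  linear_part x *m linear_part y = linear_part y *m linear_part x ->
  linear_part [~ x, y]%g = 1%:M.
Proof.
rewrite -!linear_partM => xy; apply: (can_inj (mulKmx (SA2Z_unitmx (y * x)%g))).
rewrite mulmx1; apply: (etrans _ xy).
by rewrite -[RHS]/(linear_part (x * y)%g) [in RHS]commgC.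
Qed.

Lemma derived_subgroup_sub (G : groupType) (H K : set G) : subgroup K ->
  (forall x y, H x -> H y -> K [~ x, y]%g) -> derived_subgroup H `<=` K.
Proof.
by move=> sgK HK; apply: generated_sub => // _ [x Hx [y Hy <-]]; exact: HK.
Qed.

Lemma derived_translations (H : set SA2Z) :
  (forall g, H g -> linear_part g = 1%:M) -> derived_subgroup H = [set 1%g].
Proof.
move=> H1; apply/seteqP; split.
  rewrite -generated1; apply: derived_subgroup_sub => [|x y /H1 x1 /H1 y1].
    exact: generated_subgroup.
  rewrite generated1; apply: commg_eq1; apply: SA2Z_eq.
    by rewrite !linear_partM x1 y1.
  by rewrite !translation_partM x1 y1 !mul1mx addrC.
by move=> _ ->; apply: subgroup1; exact: generated_subgroup.
Qed.

Lemma linear_part1_subgroup : subgroup [set g : SA2Z | linear_part g = 1%:M].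
Proof.
apply/subgroupP; split=> // x y /= x1 y1.
by rewrite linear_partM linear_partV x1 y1 mul1mx invmx1.
Qed.

Lemma derived2_linear_abelian (H : set SA2Z) :
  (forall x y, H x -> H y ->
    linear_part x *m linear_part y = linear_part y *m linear_part x) ->
  derived_subgroup (derived_subgroup H) = [set 1%g].
Proof.
move=> Hab; apply: derived_translations; apply: derived_subgroup_sub.
  exact: linear_part1_subgroup.
by move=> x y Hx Hy; apply: linear_part_commg; exact: Hab.
Qed.

Section Twist.
Variable A : 'M[int]_2.
Hypothesis uA : A \in unitmx.

Definition twist (e : bool) := if e then invmx A else A.

(** Conjugation by the linear part of [g] sends [A] to itself or, when [e] is
    true, to its inverse; when [A] is hyperbolic, these are the elements whose
    linear part permutes its two eigenlines. *)
Definition twisted e (g : SA2Z) :=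
  linear_part g *m A = twist e *m linear_part g.

Lemma twisted_twist e f g :
  twisted e g -> linear_part g *m twist f = twist (e (+) f) *m linear_part g.
Proof.
rewrite /twisted; case: f e => -[] //=.
- move=> gA; apply: (can_inj (mulmxK uA)).
  by rewrite mulmxKV// -mulmxA gA mulKVmx.
- move=> gA; apply: (can_inj (mulmxK uA)).
  by rewrite mulmxKV// -mulmxA gA mulKmx.
Qed.

Lemma twistedM e f g h : twisted e g -> twisted f h -> twisted (e (+) f) (g * h)%g.
Proof.
move=> ge hf; rewrite /twisted linear_partM -mulmxA hf !mulmxA.
by rewrite (twisted_twist f ge).
Qed.

Lemma twistedV e g : twisted e g -> twisted e g^-1%g.
Proof.
move=> ge; rewrite /twisted linear_partV.
apply: (can_inj (mulKmx (SA2Z_unitmx g))).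
rewrite mulKVmx ?SA2Z_unitmx// mulmxA (twisted_twist e ge) addbb.
by rewrite mulmxK ?SA2Z_unitmx.
Qed.

Lemma twisted1 : twisted false 1%g.
Proof. by rewrite /twisted mul1mx mulmx1. Qed.

Lemma twisted_subgroup : subgroup [set g | exists e, twisted e g].
Proof.
apply/subgroupP; split; first by exists false; exact: twisted1.
by move=> x y [e xe] [f yf]; exists (e (+) f); apply: twistedM; last exact: twistedV.
Qed.

Lemma untwisted_subgroup : subgroup [set g | twisted false g].
Proof.
apply/subgroupP; split; first exact: twisted1.
by move=> x y x0 y0; apply: (@twistedM false false) => //; exact: twistedV.
Qed.

Lemma twisted_commg e f g h : twisted e g -> twisted f h -> twisted false [~ g, h]%g.
Proof.
move=> ge hf; rewrite /commg/conjg.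
have := twistedM (twistedV ge) (twistedM (twistedV hf) (twistedM ge hf)).
by case: (e) (f) => -[].
Qed.

End Twist.

(** Commutators of elements normalizing [A] up to inversion have their linear
    part in the commutative centralizer of [A], so the derived length is at
    most 3. *)
Lemma twisted_solvable (A : 'M[int]_2) (H : set SA2Z) :
  \det A = 1 -> 4 < \tr A ^+ 2 ->
  (forall g, H g -> exists e, twisted A e g) -> solvable_subgroup H.
Proof.
move=> dA tA HA; have uA : A \in unitmx by rewrite unitmxE dA unitr1.
exists 3; apply: derived2_linear_abelian => x y xH yH.
have H0 : derived_subgroup H `<=` [set g | twisted A false g].
  apply: derived_subgroup_sub; first exact: untwisted_subgroup.
  by move=> g h /HA[e ge] /HA[f hf]; exact: twisted_commg ge hf.
exact: hyperbolic_centralizer_commute dA tA (H0 _ xH) (H0 _ yH).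
Qed.

Lemma generated_linear_abelian (S : set SA2Z) :
  (forall x y, S x -> S y ->
    linear_part x *m linear_part y = linear_part y *m linear_part x) ->
  forall x y, generated S x -> generated S y ->
    linear_part x *m linear_part y = linear_part y *m linear_part x.
Proof.
move=> Sab.
pose C (x : SA2Z) : set SA2Z :=
  [set y | linear_part x *m linear_part y = linear_part y *m linear_part x].
have sgC x : subgroup (C x).
  apply/subgroupP; split=> [|y z /= xy xz]; first by rewrite /C/= mulmx1 mul1mx.
  have uz := SA2Z_unitmx z.
  rewrite /C/= linear_partM linear_partV mulmxA xy -!mulmxA; congr (_ *m _).
  apply: (can_inj (mulKmx uz)); apply: (can_inj (mulmxK uz)).
  by rewrite !mulmxA mulmxV// mul1mx -xz -mulmxA mulVmx// mulmx1.
have SC x : S x -> generated S `<=` C x.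
  by move=> Sx; apply: generated_sub => // y Sy; exact: Sab.
move=> x y Gx; suff : generated S `<=` C x by apply.
by apply: generated_sub => // z Sz; rewrite /C/= (SC z).
Qed.

(** If no element of [S] and no commutator of two elements of [S], a word of
    length 4, is hyperbolic, then the linear parts of the elements of [S] commute
    and the group that they generate is metabelian. *)
Lemma exists_hyperbolic (S : set SA2Z) : symmetric_set S -> S 1%g ->
  ~ virtually_solvable (generated S) ->
  exists h, set_power S 4 h /\ 4 < \tr (linear_part h) ^+ 2.
Proof.
move=> symS S1 nvs; apply: contrapT => nohyp; apply: nvs.
have nonhyp h : set_power S 4 h -> \tr (linear_part h) ^+ 2 <= 4.
  by move=> Sh; rewrite leNgt; apply/negP => h4; apply: nohyp; exists h.
apply: solvable_virtually_solvable; first exact: generated_subgroup.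
exists 2; apply: derived2_linear_abelian; apply: generated_linear_abelian.
move=> x y Sx Sy; have S4 z : S z -> set_power S 4 z.
  by move=> Sz; apply: (@leq_set_power _ S 1 4) => //; exact: set_power1.
apply: commutator_trace_commute; rewrite ?linear_part_det//.
- by apply: nonhyp; exact: S4.
- by apply: nonhyp; exact: S4.
have : set_power S (1 + 1 + 1 + 1) (x * y * x^-1 * y^-1)%g.
  by do !apply: set_powerM; apply: set_power1 => //; exact: symmetric_setV.
have sqr_le4 (t : int) : t ^+ 2 <= 4 -> t <= 2 by nia.
by move=> /nonhyp; exact: sqr_le4.
Qed.

(** If [s1] moves [p] but its linear part normalizes [A] up to inversion, and
    [s2] behaves the other way round, then [s1 s2] moves [p] like [s1] and
    escapes the normalizer like [s2]. *)
Lemma exists_transverse (R : realType) (S : set SA2Z) (A : 'M[int]_2) (p : plane R) :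
  S 1%g -> ~ virtually_solvable (generated S) ->
  ~ has_global_fixed_point (affine_action R) (generated S) ->
  \det A = 1 -> 4 < \tr A ^+ 2 ->
  exists s, [/\ set_power S 2 s, affine_map s p <> p & forall e, ~ twisted A e s].
Proof.
move=> S1 nvs nfix dA tA; have uA : A \in unitmx by rewrite unitmxE dA unitr1.
have [s1 Ss1 s1p] : exists2 s, S s & affine_map s p <> p.
  apply: contrapT => Sp; apply: nfix; exists p.
  apply: generated_sub => [|s Ss]; last by apply: contrapT => sp; apply: Sp; exists s.
  apply/subgroupP; split=> [|x y /= xp yp]; first exact: affine_map1.
  have yVp : affine_map y^-1%g p = p.
    by rewrite -{1}yp -affine_mapM mulVg affine_map1.
  by rewrite affine_mapM yVp.
have [s2 Ss2 s2A] : exists2 s, S s & forall e, ~ twisted A e s.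
  apply: contrapT => SA; apply: nvs; apply: solvable_virtually_solvable.
    exact: generated_subgroup.
  apply: (twisted_solvable dA tA); apply: generated_sub.
    exact: twisted_subgroup.
  move=> s Ss; apply: contrapT => sA; apply: SA; exists s => // e se.
  by apply: sA; exists e.
have S2 s : S s -> set_power S 2 s.
  by move=> Ss; apply: (@leq_set_power _ S 1 2) => //; exact: set_power1.
have [s2p|s2p] := pselect (affine_map s2 p = p); last first.
  by exists s2; split=> //; exact: S2.
have [[e s1A]|s1A] := pselect (exists e, twisted A e s1); last first.
  by exists s1; split=> [||e s1e]//; [exact: S2|apply: s1A; exists e].
exists (s1 * s2)%g; split.
- by apply: (@set_powerM _ S 1 1); exact: set_power1.
- by rewrite affine_mapM s2p.
- move=> f s12; apply: (s2A (e (+) f)).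
  by rewrite -(mulKg s1 s2); apply: twistedM => //; exact: twistedV.
Qed.

(** * Finitely additive measures and cones *)

Section AlmostInvariance.
Context {R : realType} {d : measure_display} {X : measurableType d}.
Variables (mu : {content set X -> \bar R}) (mu1 : mu setT = 1%E).
Implicit Types (A B C : set X) (f h : X -> R).

Definition mass A : R := fine (mu A).

Lemma massE A : measurable A -> mu A = (mass A)%:E.
Proof.
move=> mA; rewrite fineK// ge0_fin_numE ?measure_ge0//.
apply: (@le_lt_trans _ _ (mu setT)); last by rewrite mu1 ltry.
by apply: le_measure; rewrite ?inE.
Qed.

Lemma massT : mass setT = 1.
Proof. by rewrite /mass mu1. Qed.

Lemma le_mass A B : measurable A -> measurable B -> A `<=` B -> mass A <= mass B.
Proof.
by move=> mA mB AB; rewrite -lee_fin -!massE//; apply: le_measure; rewrite ?inE.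
Qed.

Lemma massU A B : measurable A -> measurable B -> A `&` B = set0 ->
  mass (A `|` B) = mass A + mass B.
Proof.
move=> mA mB AB; apply: EFin_inj; rewrite EFinD -!massE ?measureU//.
exact: measurableU.
Qed.

Lemma massU_le A B : measurable A -> measurable B ->
  mass (A `|` B) <= mass A + mass B.
Proof.
move=> mA mB; rewrite -lee_fin EFinD -!massE ?measureU2//.
exact: measurableU.
Qed.

Lemma massD A B : measurable A -> measurable B -> B `<=` A ->
  mass (A `\` B) = mass A - mass B.
Proof.
move=> mA mB BA; rewrite -{2}(setDUK BA) massU ?setDIK//; first by rewrite addrC addKr.
exact: measurableD.
Qed.

Definition almost_invariant (g : X -> X) (eps : R) :=
  forall A, measurable A -> `|mass (g @^-1` A) - mass A| <= eps.

(** For [r > 0] and large [k], a neighborhood of the axis [h = 0] at infinity. *)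
Definition cone (r k : R) f h : set X :=
  [set z | r <= `|f z|] `&` [set z | k * `|h z| <= `|f z|].

Lemma measurable_cone r k f h : measurable_fun setT f -> measurable_fun setT h ->
  measurable (cone r k f h).
Proof.
move=> mf mh; apply: measurableI; rewrite -[X in measurable X]setTI.
  apply: measurable_fun_le => //.
  by apply: measurableT_comp => //; exact: normr_measurable.
apply: measurable_fun_le => //.
  apply: measurable_funM => //.
  by apply: measurableT_comp => //; exact: normr_measurable.
by apply: measurableT_comp => //; exact: normr_measurable.
Qed.

Lemma cone_subset r r' k k' f h : r' <= r -> k' <= k ->
  cone r k f h `<=` cone r' k' f h.
Proof.
move=> rr kk z [/= rz kz]; split=> /=; first exact: le_trans rz.
by apply: le_trans kz; rewrite ler_wpM2r.
Qed.

Lemma preimage_cone_expanding (L r k : R) (g : X -> X) f h : 0 < L ->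
  (forall z, f (g z) = L * f z) -> (forall z, h (g z) = L^-1 * h z) ->
  g @^-1` (cone (L * r) (L ^+ 2 * k) f h) = cone r k f h.
Proof.
move=> L0 fg hg; have LV : 0 < L^-1 by rewrite invr_gt0.
apply/seteqP; split=> z; rewrite /cone/= fg hg !normrM !(gtr0_norm L0) (gtr0_norm LV).
  rewrite ler_pM2l// => -[rz kz]; split=> //.
  move: kz; rewrite (_ : _ * (_ * _) = L * (k * `|h z|)) ?ler_pM2l//.
  by field; rewrite gt_eqF.
move=> [rz kz]; rewrite ler_pM2l//; split=> //.
rewrite (_ : _ * (_ * _) = L * (k * `|h z|)) ?ler_pM2l//.
by field; rewrite gt_eqF.
Qed.

Lemma preimage_cone_contracting (L r k : R) (g : X -> X) f h : 0 < L ->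
  (forall z, f (g z) = L^-1 * f z) -> (forall z, h (g z) = L * h z) ->
  g @^-1` (cone r k f h) = cone (L * r) (L ^+ 2 * k) f h.
Proof.
move=> L0 fg hg; have hg' z : h (g z) = L^-1^-1 * h z by rewrite invrK.
have LV : 0 < L^-1 by rewrite invr_gt0.
rewrite -(preimage_cone_expanding (L * r) (L ^+ 2 * k) LV fg hg').
by congr (_ @^-1` cone _ _ _ _); field; rewrite gt_eqF.
Qed.

(** What almost invariance under a map multiplying [f] by [L] and [h] by [L^-1]
    gives on cones: the cone on the right is the image of the one on the left.  The
    roles of [f] and [h] are exchanged by passing to the inverse map. *)
Definition shrinking (eps L : R) f h := forall r k,
  mass (cone r k f h) <= mass (cone (L * r) (L ^+ 2 * k) f h) + eps.

Lemma almost_invariant_shrinking (g : X -> X) (eps L : R) f h : 0 < L ->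
  measurable_fun setT f -> measurable_fun setT h ->
  (forall z, f (g z) = L * f z) -> (forall z, h (g z) = L^-1 * h z) ->
  almost_invariant g eps -> shrinking eps L f h /\ shrinking eps L h f.
Proof.
move=> L0 mf mh fg hg ig; split=> r k.
  have := ig _ (measurable_cone (L * r) (L ^+ 2 * k) mf mh).
  by rewrite preimage_cone_expanding// => /ler_normlP[_]; lra.
have := ig _ (measurable_cone r k mh mf).
by rewrite (@preimage_cone_contracting L)// => /ler_normlP[+ _]; lra.
Qed.

(** A square around the common zero of [f] and [h], together with the image of
    [cone r 1 f h] under a map that multiplies [f] by [L] and [h] by [L^-1], and
    the image of [cone r 1 h f] under the inverse of this map. *)
Definition core (r L : R) f h : set X :=
  ([set z | `|f z| <= r] `&` [set z | `|h z| <= r]) `|`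
  (cone (L * r) (L ^+ 2) f h `|` cone (L * r) (L ^+ 2) h f).

Lemma measurable_core r L f h : measurable_fun setT f -> measurable_fun setT h ->
  measurable (core r L f h).
Proof.
move=> mf mh; apply: measurableU; last by apply: measurableU; exact: measurable_cone.
by apply: measurableI; rewrite -[X in measurable X]setTI;
  apply: measurable_fun_le => //; apply: measurableT_comp => //;
  exact: normr_measurable.
Qed.

(** Outside the core, a point lies in [cone r 1 f h] but not in its image, or in
    [cone r 1 h f] but not in its image under the inverse map.  Both differences
    are wandering and have mass at most [eps]. *)
Lemma mass_core (eps r L : R) f h : 0 <= r -> 1 <= L ->
  measurable_fun setT f -> measurable_fun setT h ->
  shrinking eps L f h -> shrinking eps L h f -> 1 - 2 * eps <= mass (core r L f h).
Proof.
move=> r0 L1 mf mh sf sh.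
pose W f h := cone r 1 f h `\` cone (L * r) (L ^+ 2) f h.
have mW f' h' : measurable_fun setT f' -> measurable_fun setT h' ->
    measurable (W f' h').
  by move=> mf' mh'; apply: measurableD; exact: measurable_cone.
have W_le f' h' : measurable_fun setT f' -> measurable_fun setT h' ->
    shrinking eps L f' h' -> mass (W f' h') <= eps.
  move=> mf' mh' s; rewrite massD; [|exact: measurable_cone..|]; last first.
    by apply: cone_subset; [rewrite ler_peMl|rewrite expr_ge1// (le_trans ler01)].
  by have := s r 1; rewrite mulr1; lra.
have : setT `<=` core r L f h `|` (W f h `|` W h f).
  move=> z _; have [fr|/ltW fr] := leP `|f z| r; have [hr|/ltW hr] := leP `|h z| r.
  - by left; left.
  - have [Lz|Lz] := pselect (cone (L * r) (L ^+ 2) h f z); first by left; right; right.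
    by right; right; split=> //; split=> //=; rewrite mul1r (le_trans fr).
  - have [Lz|Lz] := pselect (cone (L * r) (L ^+ 2) f h z); first by left; right; left.
    by right; left; split=> //; split=> //=; rewrite mul1r (le_trans hr).
  - have [fh|/ltW fh] := leP `|f z| `|h z|.
      have [Lz|Lz] := pselect (cone (L * r) (L ^+ 2) h f z); first by left; right; right.
      by right; right; split=> //; split=> //=; rewrite mul1r.
    have [Lz|Lz] := pselect (cone (L * r) (L ^+ 2) f h z); first by left; right; left.
    by right; left; split=> //; split=> //=; rewrite mul1r.
have mK := measurable_core r L mf mh.
have mWU : measurable (W f h `|` W h f) by apply: measurableU; exact: mW.
move=> /(le_mass measurableT (measurableU _ _ mK mWU)); rewrite massT.
have := massU_le mK mWU; have := massU_le (mW _ _ mf mh) (mW _ _ mh mf).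
have := W_le _ _ mf mh sf; have := W_le _ _ mh mf sh; lra.
Qed.

(** The difference of a cone and of its image has mass at most [eps], since the
    image is contained in the cone. *)
Lemma mass_wandering (eps r k L : R) f h K : 0 <= r -> 0 <= k -> 1 <= L ->
  measurable_fun setT f -> measurable_fun setT h -> measurable K ->
  shrinking eps L f h ->
  K `<=` cone r k f h `\` cone (L * r) (L ^+ 2 * k) f h -> mass K <= eps.
Proof.
move=> r0 k0 L1 mf mh mK s KW.
have mC r' k' := measurable_cone r' k' mf mh.
apply: le_trans (le_mass mK (measurableD (mC _ _) (mC _ _)) KW) _.
rewrite massD//; first by have := s r k; lra.
apply: cone_subset; first by rewrite ler_peMl.
by rewrite ler_peMl// expr_ge1// (le_trans ler01).
Qed.

End AlmostInvariance.

Section NonAmenability.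
Context {G : groupType} {R : realType} {d : measure_display} {X : measurableType d}.
Variable act : measurable_action G X.

Lemma nonamenable_forP (T : set G) (eps : R) :
  nonamenable_for act T eps <->
  forall mu : {content set X -> \bar R}, mu setT = 1%E ->
    ~ (forall g, T g -> almost_invariant mu (act g) eps).
Proof.
have tvP (mu : {content set X -> \bar R}) g : mu setT = 1%E ->
    (tv_dist (pushforward mu (act g)) mu <= eps%:E)%E <->
    almost_invariant mu (act g) eps.
  move=> mu1.
  have E A : measurable A -> (`|pushforward mu (act g) A - mu A|%E =
      `|mass mu (act g @^-1` A) - mass mu A|%:E)%E.
    move=> mA; rewrite /pushforward !(massE mu1)//.
    by rewrite -[X in measurable X]setTI; exact: act_fun_measurable.
  split=> [tv A mA|inv].
    rewrite -lee_fin -E//; apply: le_trans tv; apply: ereal_sup_ubound.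
    by exists A.
  by apply: ge_ereal_sup => _ [A mA <-]; rewrite E// lee_fin; exact: inv.
split=> H mu mu1; have := H mu mu1.
  rewrite ltNge => /negP nsup inv; apply: nsup.
  by apply: ge_ereal_sup => _ [g Tg <-]; apply/tvP => //; exact: inv.
move=> ninv; rewrite ltNge; apply/negP => sup; apply: ninv => g Tg; apply/tvP => //.
by apply: le_trans sup; apply: ereal_sup_ubound; exists g.
Qed.

Variable mu : {content set X -> \bar R}.

Lemma almost_invariant_mulg (eps eps' : R) g h : almost_invariant mu (act g) eps ->
  almost_invariant mu (act h) eps' ->
  almost_invariant mu (act (g * h)%g) (eps + eps').
Proof.
move=> ig ih A mA.
have mg : measurable (act g @^-1` A).
  by rewrite -[X in measurable X]setTI; exact: act_fun_measurable.
rewrite (_ : act (g * h)%g @^-1` A = act h @^-1` (act g @^-1` A)); last first.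
  by apply/seteqP; split=> z; rewrite /= act_funM.
have := ler_normD (mass mu (act h @^-1` (act g @^-1` A)) - mass mu (act g @^-1` A))
  (mass mu (act g @^-1` A) - mass mu A).
rewrite addrA subrK => /le_trans; apply.
by rewrite addrC lerD//; [exact: ig|exact: ih].
Qed.

Lemma almost_invariantV (eps : R) g : almost_invariant mu (act g) eps ->
  almost_invariant mu (act g^-1%g) eps.
Proof.
move=> ig A mA.
have mg : measurable (act g^-1%g @^-1` A).
  by rewrite -[X in measurable X]setTI; exact: act_fun_measurable.
have := ig _ mg; rewrite distrC.
rewrite (_ : act g @^-1` _ = A)//; apply/seteqP; split=> z /=;
  by rewrite -act_funM mulVg act_fun1.
Qed.

Lemma almost_invariant_set_power (eps : R) (S : set G) n g :
  (forall s, S s -> almost_invariant mu (act s) eps) ->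
  set_power S n g -> almost_invariant mu (act g) (eps *+ n).
Proof.
move=> iS; elim: n g => [g [s [_ ->]] A mA|n IH g].
  rewrite big_ord0 (_ : act _ @^-1` A = A) ?subrr ?normr0//.
  by apply/seteqP; split=> z; rewrite /= act_fun1.
move=> /set_powerS[x [y [/IH Sx /iS Sy ->]]]; rewrite mulrSr.
exact: almost_invariant_mulg.
Qed.

End NonAmenability.

(** * Two maps with transverse axes *)

Section PingPong.
Context {R : realType}.
Implicit Types x y u v e f q E L chi : R.

Lemma norm_comparable u t : `|u - t| <= `|t| / 4 ->
  3 / 4 * `|t| <= `|u| /\ `|u| <= 5 / 4 * `|t|.
Proof.
move=> ut; have := ler_normD (u - t) t; rewrite subrK.
have := ler_normD (t - u) u; rewrite subrK [`|t - u|]distrC; lra.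
Qed.

(** In the cone around the axis [y = 0] the term [x] dominates both coordinates
    [x + y + e] and [x + chi y + f]. *)
Lemma cone_image_first x y e f q chi E L : 1 <= q -> `|chi| <= q ->
  64 * q ^+ 2 <= L -> 0 < E -> `|e| <= E -> `|f| <= E ->
  L * (E / (8 * q)) <= `|x| -> L ^+ 2 * `|y| <= `|x| ->
  [/\ 8 * E <= `|x|, `|(x + y + e) - x| <= `|x| / 4 &
      `|(x + chi * y + f) - x| <= `|x| / 4].
Proof.
move=> q1 chiq Lq E0 eE fE Lx Ly.
have q0 : 0 < q by lra.
have qE : 8 * q * E <= `|x|.
  apply: le_trans Lx; rewrite (_ : 8 * q * E = 64 * q ^+ 2 * (E / (8 * q))).
    by rewrite ler_wpM2r// divr_ge0//; lra.
  by field; lra.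
have E8 : 8 * E <= `|x| by apply: le_trans qE; nra.
have qy : 64 * q * `|y| <= `|x|.
  apply: le_trans Ly; rewrite ler_wpM2r//.
  have : 1 <= L by nra.
  by nra.
have chiy : `|chi * y| <= q * `|y| by rewrite normrM ler_wpM2r.
have y16 : `|y| <= q * `|y| by rewrite ler_peMl.
split=> //.
- rewrite (_ : x + y + e - x = y + e); last by ring.
  by apply: le_trans (ler_normD _ _) _; lra.
- rewrite (_ : x + chi * y + f - x = chi * y + f); last by ring.
  by apply: le_trans (ler_normD _ _) _; lra.
Qed.

(** In the cone around the axis [x = 0] the coordinates are dominated by [y] and
    [chi y]; the lower bound on [chi] keeps the second one large. *)
Lemma cone_image_second x y e f q chi E L : 1 <= q -> 1 <= q * `|chi| ->
  64 * q ^+ 2 <= L -> 0 < E -> `|e| <= E -> `|f| <= E ->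
  L * (E / (8 * q)) <= `|y| -> L ^+ 2 * `|x| <= `|y| ->
  [/\ 8 * q * E <= `|y|, `|(x + y + e) - y| <= `|y| / 4 &
      `|(x + chi * y + f) - chi * y| <= `|chi * y| / 4].
Proof.
move=> q1 chiq Lq E0 eE fE Ly Lx.
have q0 : 0 < q by lra.
have qE : 8 * q * E <= `|y|.
  apply: le_trans Ly; rewrite (_ : 8 * q * E = 64 * q ^+ 2 * (E / (8 * q))).
    by rewrite ler_wpM2r// divr_ge0//; lra.
  by field; lra.
have E8 : 8 * E <= `|y| by apply: le_trans qE; nra.
have qx : 64 * q * `|x| <= `|y|.
  apply: le_trans Lx; rewrite ler_wpM2r//.
  have : 1 <= L by nra.
  by nra.
have x1 : `|x| <= q * `|x| by rewrite ler_peMl.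
have chiy : `|y| <= q * `|chi * y|.
  by rewrite normrM mulrA ler_peMl.
split=> //.
- rewrite (_ : x + y + e - y = x + e); last by ring.
  by apply: le_trans (ler_normD _ _) _; lra.
- rewrite (_ : x + chi * y + f - chi * y = x + f); last by ring.
  apply: le_trans (ler_normD _ _) _.
  rewrite -(ler_pM2l q0); nra.
Qed.

Lemma far_comparable u v t1 t2 q : 1 <= q ->
  `|u - t1| <= `|t1| / 4 -> `|v - t2| <= `|t2| / 4 ->
  `|t1| <= q * `|t2| -> `|t2| <= q * `|t1| ->
  `|u| <= 4 * q * `|v| /\ `|v| <= 4 * q * `|u|.
Proof.
move=> q1 /norm_comparable[u1 u2] /norm_comparable[v1 v2] t12 t21.
have qv : q * (3 / 4 * `|t2|) <= q * `|v| by rewrite ler_pM2l//; lra.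
have qu : q * (3 / 4 * `|t1|) <= q * `|u| by rewrite ler_pM2l//; lra.
have := normr_ge0 u; have := normr_ge0 v; lra.
Qed.

(** The position of the core of one map in the coordinates [u], [v] adapted to the
    other one: close to the point [(e, f)], or far away and off both axes. *)
Definition near_or_far (e f q E u v : R) :=
  (`|u - e| <= E / 4 /\ `|v - f| <= E / 4) \/
  [/\ E <= `|u|, E <= `|v|, `|u| <= 4 * q * `|v| & `|v| <= 4 * q * `|u|].

Lemma near_or_farC e f q E u v : near_or_far e f q E u v -> near_or_far f e q E v u.
Proof. by move=> [[? ?]|[? ? ? ?]]; [left|right]. Qed.

Lemma core_near_or_far {d} {X : measurableType d} (f1 f2 : X -> R) z e f q chi E L :
  1 <= q -> `|chi| <= q -> 1 <= q * `|chi| -> 64 * q ^+ 2 <= L ->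
  0 < E -> `|e| <= E -> `|f| <= E -> core (E / (8 * q)) L f1 f2 z ->
  near_or_far e f q E (f1 z + f2 z + e) (f1 z + chi * f2 z + f).
Proof.
move=> q1 chiq chiq' Lq E0 eE fE; have q0 : 0 < q by lra.
have r8 : q * (E / (8 * q)) = E / 8 by field; lra.
move=> [[/= xr yr]|[[/= r1 r2]|[/= r1 r2]]].
- left; rewrite !addrK.
  have qr : E / (8 * q) <= E / 8.
    by rewrite -r8 ler_peMl// divr_ge0//; lra.
  split; apply: le_trans (ler_normD _ _) _; first by lra.
  have : `|chi * f2 z| <= q * (E / (8 * q)) by rewrite normrM ler_pM.
  by rewrite r8; lra.
- have [x8 d1 d2] := cone_image_first q1 chiq Lq E0 eE fE r1 r2.
  have xq : `|f1 z| <= q * `|f1 z| by rewrite ler_peMl.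
  have [c1 c2] := far_comparable q1 d1 d2 xq xq.
  have [n1 _] := norm_comparable d1; have [n2 _] := norm_comparable d2.
  by right; split=> //; lra.
- have [y8 d1 d2] := cone_image_second q1 chiq' Lq E0 eE fE r1 r2.
  have yq : `|f2 z| <= q * `|chi * f2 z| by rewrite normrM mulrA ler_peMl.
  have yq' : `|chi * f2 z| <= q * `|f2 z| by rewrite normrM ler_wpM2r.
  have [c1 c2] := far_comparable q1 d1 d2 yq yq'.
  have [n1 _] := norm_comparable d1; have [n2 _] := norm_comparable d2.
  have E8 : 8 * E <= `|f2 z| by apply: le_trans y8; nra.
  have E8' : 8 * E <= `|chi * f2 z| by rewrite -(ler_pM2l q0); lra.
  by right; split=> //; lra.
Qed.

(** When [e] is the larger coordinate, points near [(e, f)] and points off the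
    axes all satisfy [|v| <= 4 q |u|] with [|u|] bounded below, and a factor
    [L >= 64 q^2] suffices to push this cone off all of them: near [(e, f)] because
    [|u|] is bounded, off the axes because [|u| <= 4 q |v|]. *)
Lemma near_or_far_wandering {d} {X : measurableType d} (g1 g2 : X -> R) z e f q E L :
  1 <= q -> 64 * q ^+ 2 <= L -> 0 < E -> `|e| = E -> `|f| <= E ->
  near_or_far e f q E (g1 z) (g2 z) ->
  (cone (3 / 4 * E) (4 * q)^-1 g1 g2 `\`
    cone (L * (3 / 4 * E)) (L ^+ 2 * (4 * q)^-1) g1 g2) z.
Proof.
move=> q1 Lq E0 eE fE H.
have q0 : 0 < q by lra.
have L64 : 64 <= L by nra.
have kP s t : ((4 * q)^-1 * s <= t) = (s <= 4 * q * t).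
  by rewrite mulrC ler_pdivrMr ?[t * _]mulrC//; lra.
case: H => [[ue vf]|[u1 v1 u2 v2]].
  have u3 : `|g1 z| <= 5 / 4 * E.
    have := ler_normD (g1 z - e) e; rewrite subrK; lra.
  have v3 : `|g2 z| <= 5 / 4 * E.
    have := ler_normD (g2 z - f) f; rewrite subrK; lra.
  have u4 : 3 / 4 * E <= `|g1 z|.
    have := ler_normD (e - g1 z) (g1 z); rewrite subrK distrC; lra.
  split; first by split=> //=; rewrite kP; nra.
  by move=> [/= Lu _]; nra.
split; first by split=> /=; [lra|rewrite kP].
move=> [_ /=]; rewrite -mulrA -[L ^+ 2]/(L * L) leNgt => /negP; apply.
have q16 : 16 * q ^+ 2 * ((4 * q)^-1 * `|g2 z|) = 4 * q * `|g2 z| by field; lra.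
have k0 : 0 < (4 * q)^-1 * `|g2 z| by rewrite mulr_gt0 ?invr_gt0//; lra.
apply: le_lt_trans u2 _; rewrite -q16 ltr_pM2r//; nra.
Qed.

(** The core of the first map has mass at least 1/2 and is wandering for the
    second map, hence of mass at most 1/4.  The second map is used in the direction
    that expands the larger of the two coordinates [e], [f]. *)
Lemma no_almost_invariant_mass {d : measure_display} {X : measurableType d}
    (mu : {content set X -> \bar R}) (f1 f2 g1 g2 : X -> R) (e f q chi L : R) :
  mu setT = 1%E ->
  measurable_fun setT f1 -> measurable_fun setT f2 ->
  measurable_fun setT g1 -> measurable_fun setT g2 ->
  1 <= q -> `|chi| <= q -> 1 <= q * `|chi| -> 64 * q ^+ 2 <= L ->
  (forall z, g1 z = f1 z + f2 z + e) ->
  (forall z, g2 z = f1 z + chi * f2 z + f) ->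
  (e, f) != (0, 0) ->
  shrinking mu 4^-1 L f1 f2 -> shrinking mu 4^-1 L f2 f1 ->
  shrinking mu 4^-1 L g1 g2 -> shrinking mu 4^-1 L g2 g1 -> False.
Proof.
move=> mu1 mf1 mf2 mg1 mg2 q1 chiq chiq' Lq g1E g2E ef sf1 sf2 sg1 sg2.
have q0 : 0 < q by lra.
have L1 : 1 <= L by nra.
pose E := Num.max `|e| `|f|.
have [eE fE] : `|e| <= E /\ `|f| <= E by rewrite /E !le_max !lexx orbT.
have E0 : 0 < E.
  rewrite /E lt_max !normr_gt0.
  by move: ef; rewrite xpair_eqE negb_and.
pose K := core (E / (8 * q)) L f1 f2.
have mK : measurable K by exact: measurable_core.
have r0 : 0 <= E / (8 * q) by rewrite divr_ge0//; lra.
have := mass_core mu1 r0 L1 mf1 mf2 sf1 sf2; rewrite -/K => K_ge.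
have KP z : K z -> near_or_far e f q E (g1 z) (g2 z).
  by move=> Kz; rewrite g1E g2E; exact: core_near_or_far Kz.
have E34 : 0 <= 3 / 4 * E by lra.
have k0 : 0 <= (4 * q)^-1 by rewrite invr_ge0; lra.
have K_le : mass mu K <= 4^-1.
  have [ef'|fe] := leP `|f| `|e|.
    have eE' : `|e| = E by rewrite /E; apply/esym/max_idPl.
    apply: (mass_wandering mu1 E34 k0 L1 mg1 mg2 mK sg1) => z /KP.
    exact: near_or_far_wandering.
  have fE' : `|f| = E by rewrite /E; apply/esym/max_idPr/ltW.
  apply: (mass_wandering mu1 E34 k0 L1 mg2 mg1 mK sg2) => z /KP/near_or_farC.
  exact: near_or_far_wandering.
by move: (mass mu K) K_ge K_le => m; clear; lra.
Qed.

End PingPong.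

(** * Eigencoordinates of a hyperbolic affine map *)

Section Eigencoordinates.
Context {R : realType}.

Lemma exists_large_eigenvalue (t : R) : 9 <= t ^+ 2 ->
  exists l : R, l ^+ 2 = t * l - 1 /\ 2 <= `|l|.
Proof.
have pos (x : R) : 0 <= x -> 9 <= x ^+ 2 ->
    exists l : R, l ^+ 2 = x * l - 1 /\ 2 <= l.
  move=> x0 x9; pose r := Num.sqrt (x ^+ 2 - 4).
  have r2 : r ^+ 2 = x ^+ 2 - 4 by rewrite sqr_sqrtr//; lra.
  have r0 : 0 <= r by exact: sqrtr_ge0.
  have x3 : 3 <= x by nra.
  have r1 : 1 <= r by nra.
  by exists ((x + r) / 2); split; [nra|lra].
move=> t9; have [t0|/ltW t0] := leP 0 t.
  have [l [lE l2]] := pos t t0 t9; exists l; split=> //.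
  by rewrite (le_trans l2)// ler_norm.
have [||l [lE l2]] := pos (- t); [by rewrite oppr_ge0|by rewrite sqrrN|].
exists (- l); split; first by rewrite sqrrN lE mulrN mulNr.
by rewrite normrN (le_trans l2)// ler_norm.
Qed.

(** The rows [(c, l - a)] and [(c, m - a)] are left eigenvectors of (a b; c d); the
    coefficients express their images under (p q; r s) in this basis, by Cramer's
    rule.  The last identity computes the trace of the product of the matrix and
    of its conjugate by (p q; r s)^-1 in that basis; when the two matrices are
    integral, it makes [al * de] a multiple of [1 / (l - m)^2] by an integer. *)
Lemma eigenbasis_change (a b c d p q r s l m : R) :
  a * d - b * c = 1 -> p * s - q * r = 1 ->
  l + m = a + d -> l * m = 1 -> c != 0 -> l != m ->
  exists al be ga de : R,
    [/\ forall x y, c * (p * x + q * y) + (l - a) * (r * x + s * y) =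
          al * (c * x + (l - a) * y) + be * (c * x + (m - a) * y),
        forall x y, c * (p * x + q * y) + (m - a) * (r * x + s * y) =
          ga * (c * x + (l - a) * y) + de * (c * x + (m - a) * y),
        al * de - be * ga = 1 &
        al * de * (l - m) ^+ 2 =
          (a * (s * (a * p + b * r) - q * (c * p + d * r)) +
           b * (- r * (a * p + b * r) + p * (c * p + d * r))) +
          (c * (s * (a * q + b * s) - q * (c * q + d * s)) +
           d * (- r * (a * q + b * s) + p * (c * q + d * s))) - 2].
Proof.
move=> detA detS trA lm c0 lm0.
have lm0' : m - l != 0 by rewrite subr_eq0 eq_sym.
pose u0 := c * p + (l - a) * r; pose u1 := c * q + (l - a) * s.
pose v0 := c * p + (m - a) * r; pose v1 := c * q + (m - a) * s.
have dE : d = l + m - a by rewrite trA; ring.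
have bE : b = (a * (l + m - a) - l * m) / c.
  by apply: (canRL (mulfK c0)); rewrite lm -detA dE; ring.
exists ((u0 * (m - a) - u1 * c) / (c * (m - l))),
  ((c * u1 - (l - a) * u0) / (c * (m - l))),
  ((v0 * (m - a) - v1 * c) / (c * (m - l))),
  ((c * v1 - (l - a) * v0) / (c * (m - l))).
split.
- by move=> x y; rewrite /u0 /u1; field; rewrite lm0' c0.
- by move=> x y; rewrite /v0 /v1; field; rewrite lm0' c0.
- by rewrite -detS /u0 /u1 /v0 /v1; field; rewrite lm0' c0.
- have -> : 2 = 2 * (l * m) * (p * s - q * r) by rewrite lm detS !mulr1.
  by rewrite /u0 /u1 /v0 /v1 bE dE; field; rewrite lm0' c0.
Qed.

Definition eigenform (c l : R) (p z : plane R) : R :=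
  c * (z 0 0 - p 0 0) + l * (z 1 0 - p 1 0).

Lemma affine_mapE (g : SA2Z) (z : 'cV[R]_2) i : affine_map g z i 0 =
  (linear_part g i 0)%:~R * z 0 0 + (linear_part g i 1)%:~R * z 1 0 +
  (translation_part g i 0)%:~R.
Proof. by rewrite /affine_map mxE mulmx2E !mxE. Qed.

Lemma affine_mapB (g : SA2Z) (z w : plane R) i :
  affine_map g z i 0 - affine_map g w i 0 =
  (linear_part g i 0)%:~R * (z 0 0 - w 0 0) +
  (linear_part g i 1)%:~R * (z 1 0 - w 1 0).
Proof. by rewrite !affine_mapE; ring. Qed.

Lemma eigenform_affine (g : SA2Z) (p z : plane R) (l : R)
    (A := linear_part g) : affine_map g p = p ->
  l ^+ 2 = (\tr A)%:~R * l - 1 ->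
  eigenform (A 1 0)%:~R (l - (A 0 0)%:~R) p (affine_map g z) =
  l * eigenform (A 1 0)%:~R (l - (A 0 0)%:~R) p z.
Proof.
move=> gp lE; have dA := congr1 (intr : int -> R) (linear_part_det g).
rewrite -/A det2E intrD intrN !intrM in dA; rewrite mxtrace2 intrD in lE.
rewrite /eigenform -[in LHS]gp !affine_mapB -/A.
move: dA lE.
set a := (A 0 0)%:~R; set b := (A 0 1)%:~R; set c := (A 1 0)%:~R.
set d := (A 1 1)%:~R; set x := z 0 0 - _; set y := z 1 0 - _ => dA lE.
apply/eqP; rewrite -subr_eq0; apply/eqP.
rewrite (_ : _ - _ = - y * (l ^+ 2 - ((a + d) * l - (a * d - b * c)))); last by ring.
by rewrite dA lE subrr mulr0.
Qed.

Lemma eigenform_affineX (g : SA2Z) (p z : plane R) (l : R) n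
    (A := linear_part g) : affine_map g p = p ->
  l ^+ 2 = (\tr A)%:~R * l - 1 ->
  eigenform (A 1 0)%:~R (l - (A 0 0)%:~R) p (affine_map (g ^+ n)%g z) =
  l ^+ n * eigenform (A 1 0)%:~R (l - (A 0 0)%:~R) p z.
Proof.
move=> gp lE; elim: n => [|n IH]; first by rewrite affine_map1 expr0 mul1r.
by rewrite expgS affine_mapM eigenform_affine// IH exprS mulrA.
Qed.

Lemma affine_map_fixed_point (g : SA2Z) : \tr (linear_part g) != 2 ->
  exists p : plane R, affine_map g p = p.
Proof.
move=> tr2; set A := map_mx intr (linear_part g) : 'M[R]_2.
have u1A : 1%:M - A \in unitmx.
  rewrite unitmxE unitfE det2E !mxE/=.
  have := linear_part_det g; move: tr2; rewrite det2E mxtrace2.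
  move: (linear_part g) => M tr2 dM.
  have -> : (1 - (M 0 0)%:~R) * (1 - (M 1 1)%:~R) -
      (0 - (M 0 1)%:~R) * (0 - (M 1 0)%:~R) = (2 - (M 0 0 + M 1 1))%:~R :> R.
    have := congr1 (intr : int -> R) dM; rewrite !(intrD, intrN, intrM) => dM'.
    lra.
  by rewrite intr_eq0 subr_eq0 eq_sym.
pose p := invmx (1%:M - A) *m map_mx intr (translation_part g).
exists p; rewrite /affine_map -/A.
have : (1%:M - A) *m p = map_mx intr (translation_part g) by rewrite mulKVmx.
by rewrite mulmxBl mul1mx => <-; rewrite addrC subrK.
Qed.

Lemma measurable_coordinate i : measurable_fun setT (fun z : plane R => z i 0).
Proof.
apply: (measurability _ (RGenOpens.measurableE R)).
move=> _ [_ [a [b ->] <-]]; rewrite setTI; apply: sub_sigma_algebra.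
apply: open_comp; last exact: interval_open.
by move=> z _; exact: (@coord_continuous R 2 1 i 0).
Qed.

Lemma measurable_eigenform c l p : measurable_fun setT (eigenform c l p).
Proof.
by apply: measurable_funD; apply: measurable_funM => //;
  apply: measurable_funB => //; exact: measurable_coordinate.
Qed.

Lemma ratio_bound (m D : int) : m != 0 -> m != D -> 0 < D ->
  (`|m| <= (1 + D) * `|m - D|) /\ (`|m - D| <= (1 + D) * `|m|).
Proof.
move=> m0; rewrite -subr_eq0 => mD D0.
have m1 : 1 <= `|m| by rewrite -gtz0_ge1 normr_gt0.
have mD1 : 1 <= `|m - D| by rewrite -gtz0_ge1 normr_gt0.
have := ler_normD (m - D) D; rewrite subrK (gtr0_norm D0).
have := ler_normD m (- D); rewrite normrN (gtr0_norm D0).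
nia.
Qed.

End Eigencoordinates.

(** The two excluded values are the traces of [A * A^-1] and [A * A], minus 2. *)
Lemma transverse_trace (h s : SA2Z) (A := linear_part h) (T := linear_part s) :
  4 < \tr A ^+ 2 -> (forall e, ~ twisted A e s) ->
  let m := \tr (A *m (T *m A *m invmx T)) - 2 in
  m != 0 /\ m != \tr A ^+ 2 - 4.
Proof.
move=> tA nt m; have uT := SA2Z_unitmx s.
have dA : \det A = 1 := linear_part_det h.
have dB : \det (T *m A *m invmx T) = 1.
  by rewrite !det_mulmx det_inv dA linear_part_det invr1 !mulr1.
have tB : \tr (T *m A *m invmx T) = \tr A by rewrite mxtrace_mulC mulKmx.
have [B2 Bt] := conjugate_trace_dichotomy dA dB tB tA.
split; apply/eqP => mE.
  apply: (nt true); rewrite /twisted/= -B2 ?mulmxKV//.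
  by apply/eqP; rewrite -subr_eq0; apply/eqP.
apply: (nt false); rewrite /twisted/= -{2}Bt ?mulmxKV//.
by apply: (addIr (- 2)); rewrite [LHS]mE; ring.
Qed.

(** [1 + (l - m)^2 = l^2 + m^2 - 1 <= l^2], and [64 <= l^6]. *)
Lemma tenth_power_bound (R : realType) (l m : R) : l * m = 1 -> 2 <= `|l| ->
  64 * (1 + (l - m) ^+ 2) ^+ 2 <= l ^+ 10.
Proof.
move=> lm1 l2; have lm2 : l ^+ 2 * m ^+ 2 = 1 by rewrite -exprMn lm1 expr1n.
have : 4 <= l ^+ 2 by rewrite -real_normK ?num_real//; nra.
have -> : 1 + (l - m) ^+ 2 = l ^+ 2 + m ^+ 2 + (1 - 2 * (l * m)) by ring.
rewrite lm1 -[l ^+ 10]/(l ^+ (2 * 5)) exprM.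
move: (l ^+ 2) (m ^+ 2) (sqr_ge0 m) lm2 => x y y0 xy x4.
have y1 : y <= 1 by nra.
have x3 : 64 <= x ^+ 3.
  by rewrite (_ : 64 = 4 ^+ 3); [apply: lerXn2r; rewrite ?nnegrE; lra|ring].
rewrite -[x ^+ 5]/(x ^+ (3 + 2)) exprD ler_pM// ?sqr_ge0//.
by apply: lerXn2r; rewrite ?nnegrE; lra.
Qed.

Lemma hyperbolic_eigenvalues (R : realType) (A : 'M[int]_2) :
  4 < \tr A ^+ 2 -> exists l m : R, [/\ l * m = 1, l + m = (\tr A)%:~R,
    (\tr A ^+ 2 - 4)%:~R = (l - m) ^+ 2 &
    64 * (1 + (\tr A ^+ 2 - 4)%:~R) ^+ 2 <= l ^+ 10].
Proof.
move=> tr4; pose t : R := (\tr A)%:~R.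
have t9 : 9 <= t ^+ 2.
  rewrite -[t]/((\tr A)%:~R) -rmorphXn -[9]/(9%:~R) ler_int.
  move: (\tr A) tr4 => u u4; have [u0|u0] := lerP 0 u.
    have u3 : 3 <= u by nia.
    by nia.
  have u3 : u <= - 3 by nia.
  by nia.
have [l [lE l2]] := exists_large_eigenvalue t9.
have l0 : l != 0 by rewrite -normr_gt0 (lt_le_trans _ l2).
have lm1 : l * l^-1 = 1 by rewrite divff.
have lmt : l + l^-1 = t.
  by apply: (mulfI l0); rewrite mulrDr lm1 -expr2 lE mulrC; ring.
have DE : (\tr A ^+ 2 - 4)%:~R = (l - l^-1) ^+ 2.
  have -> : (l - l^-1) ^+ 2 = t ^+ 2 - 4 * (l * l^-1) by rewrite -lmt; ring.
  by rewrite lm1 mulr1 rmorphB rmorphXn.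
by exists l, l^-1; split=> //; rewrite DE; exact: tenth_power_bound.
Qed.

(** The linear part of [s^-1] in eigencoordinates of [A].  Its coefficients may be
    arbitrarily large or small, but the cross-ratio is [M / (M - D)] for integers
    [M] and [D], and so it is bounded in both directions in terms of [D] alone. *)
Lemma transverse_frame (R : realType) (h s : SA2Z) (l m : R)
    (A := linear_part h) (V := linear_part s^-1%g) :
  4 < \tr A ^+ 2 -> (forall e, ~ twisted A e s) ->
  l * m = 1 -> l + m = (\tr A)%:~R -> (\tr A ^+ 2 - 4)%:~R = (l - m) ^+ 2 ->
  let q := 1 + (\tr A ^+ 2 - 4)%:~R in
  exists al be ga de : R,
    [/\ forall x y, (A 1 0)%:~R * ((V 0 0)%:~R * x + (V 0 1)%:~R * y) +
            (l - (A 0 0)%:~R) * ((V 1 0)%:~R * x + (V 1 1)%:~R * y) =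
          al * ((A 1 0)%:~R * x + (l - (A 0 0)%:~R) * y) +
          be * ((A 1 0)%:~R * x + (m - (A 0 0)%:~R) * y),
        forall x y, (A 1 0)%:~R * ((V 0 0)%:~R * x + (V 0 1)%:~R * y) +
            (m - (A 0 0)%:~R) * ((V 1 0)%:~R * x + (V 1 1)%:~R * y) =
          ga * ((A 1 0)%:~R * x + (l - (A 0 0)%:~R) * y) +
          de * ((A 1 0)%:~R * x + (m - (A 0 0)%:~R) * y),
        [/\ al != 0, be != 0, ga != 0 & de != 0],
        `|(al * de) / (be * ga)| <= q &
        1 <= q * `|(al * de) / (be * ga)|].
Proof.
move=> tr4 nt lm1 lmt; have [M0 MD] := transverse_trace tr4 nt.
set M := _ - 2 in M0 MD; set D := _ - 4 in MD * => DE q.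
have D0 : 0 < D by rewrite subr_gt0.
have lm : l != m.
  by apply: contraTneq D0 => lm; rewrite -(ltr_int R) DE lm subrr expr0n ltxx.
have dA : \det A = 1 := linear_part_det h.
have [b0 c0] : A 0 1 != 0 /\ A 1 0 != 0.
  by move: dA tr4; rewrite det2E mxtrace2; exact: hyperbolic_offdiagonal.
have c0' : (A 1 0)%:~R != 0 :> R by rewrite intr_eq0.
have dV : \det V = 1 := linear_part_det _.
have detR (Z : 'M[int]_2) : \det Z = 1 ->
    (Z 0 0)%:~R * (Z 1 1)%:~R - (Z 0 1)%:~R * (Z 1 0)%:~R = 1 :> R.
  by move=> /(congr1 (intr : int -> R)); rewrite det2E intrD intrN !intrM.
have trR : l + m = (A 0 0)%:~R + (A 1 1)%:~R by rewrite lmt mxtrace2 intrD.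
have [al [be [ga [de [xE yE det1 alde]]]]] :=
  eigenbasis_change (detR _ dA) (detR _ dV) trR lm1 c0' lm.
exists al, be, ga, de.
have MR : al * de * D%:~R = M%:~R.
  rewrite DE alde /M; set B := (X in A *m X).
  rewrite (_ : B = invmx V *m A *m V); last by rewrite /V linear_partV invmxK.
  rewrite mxtrace2 !mulmx2E !(invmx2E dV) !(intrD, intrN, intrM); ring.
have MDR : be * ga * D%:~R = (M - D)%:~R.
  have -> : (M - D)%:~R = M%:~R - D%:~R :> R by exact: rmorphB.
  by rewrite -MR -[X in _ - X]mul1r -det1; ring.
clearbody M; have D0R : 0 < D%:~R :> R by rewrite ltr0z.
have MR0 : al * de != 0.
  by apply: contraNneq M0 => E; rewrite -(intr_eq0 R) -MR E mul0r.
have MDR0 : be * ga != 0.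
  by apply: contraNneq MD => E; rewrite -subr_eq0 -(intr_eq0 R) -MDR E mul0r.
have [r1 r2] := ratio_bound M0 MD D0.
have rI (i j : int) (x y : R) : x * D%:~R = i%:~R -> y * D%:~R = j%:~R ->
    `|i| <= (1 + D) * `|j| -> `|x| <= q * `|y|.
  move=> xi yj ij; rewrite -(ler_pM2r D0R) -mulrA -{1 2}(gtr0_norm D0R) -!normrM.
  rewrite xi yj -!intr_norm -[q]/(1%:~R + D%:~R) -intrD -intrM ler_int.
  exact: ij.
split=> //.
- by move: MR0 MDR0; rewrite !mulf_eq0 !negb_or => /andP[-> ->] /andP[-> ->].
- by rewrite normrM normfV ler_pdivrMr ?normr_gt0//; exact: rI MR MDR r1.
- by rewrite normrM normfV mulrA ler_pdivlMr ?normr_gt0// mul1r; exact: rI MDR MR r2.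
Qed.

(** * Uniform non-amenability *)

(** The eigencoordinates [x], [y] of [h] centered at [p], and their translates by
    [s], rescaled so that the linear part of the change of coordinates has only one
    coefficient different from 1, satisfy the hypotheses of
    [no_almost_invariant_mass]. *)
Lemma transverse_nonamenable (R : realType) (h s : SA2Z) (p : plane R) :
  4 < \tr (linear_part h) ^+ 2 -> affine_map h p = p -> affine_map s p <> p ->
  (forall e, ~ twisted (linear_part h) e s) ->
  nonamenable_for (affine_action R)
    [set (h ^+ 10)%g; (s * h ^+ 10 * s^-1)%g] (4^-1 : R).
Proof.
move=> tr4 hp sp nt; apply/nonamenable_forP => mu mu1 inv.
have [l [m [lm1 lmt DE]]] := hyperbolic_eigenvalues R tr4.
have := transverse_frame tr4 nt lm1 lmt DE.
set A := linear_part h in tr4 nt lmt DE *; set V := linear_part s^-1%g.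
have D0R : 0 < (\tr A ^+ 2 - 4)%:~R :> R by rewrite ltr0z subr_gt0.
move: ((_ - 4)%:~R) D0R DE => D D0 DE /=.
set q := 1 + D => -[al [be [ga [de [xE yE [al0 be0 ga0 de0] chi1 chi2]]]]] qL.
have q1 : 1 <= q by rewrite /q; lra.
have lm : l - m != 0.
  by apply/eqP => lm; move: D0; rewrite DE lm expr0n ltxx.
have c0 : (A 1 0)%:~R != 0 :> R.
  rewrite intr_eq0; move: (linear_part_det h) tr4; rewrite det2E mxtrace2.
  by move=> dA /(hyperbolic_offdiagonal dA)[].
have l0 : l != 0.
  by apply/eqP => l0; move/eqP: lm1; rewrite l0 mul0r eq_sym oner_eq0.
have lE : l ^+ 2 = (\tr A)%:~R * l - 1 by rewrite -lmt -lm1; ring.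
have mE : m ^+ 2 = (\tr A)%:~R * m - 1 by rewrite -lmt -lm1; ring.
pose x := eigenform (A 1 0)%:~R (l - (A 0 0)%:~R) p.
pose y := eigenform (A 1 0)%:~R (m - (A 0 0)%:~R) p.
pose sV : plane R -> plane R := affine_map s^-1%g.
have hx z : x (affine_map (h ^+ 10)%g z) = l ^+ 10 * x z.
  exact: eigenform_affineX.
have hy z : y (affine_map (h ^+ 10)%g z) = (l ^+ 10)^-1 * y z.
  rewrite -exprVn (_ : l^-1 = m); first exact: eigenform_affineX.
  by rewrite -[LHS]mulr1 -lm1 mulKf.
have conj z : sV (affine_map (s * h ^+ 10 * s^-1)%g z) = affine_map (h ^+ 10)%g (sV z).
  by rewrite /sV -[LHS]affine_mapM -[RHS]affine_mapM -mulgA mulKg.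
have eigV (u : R) z : eigenform (A 1 0)%:~R u p (sV z) =
    (A 1 0)%:~R * ((V 0 0)%:~R * (z 0 0 - p 0 0) + (V 0 1)%:~R * (z 1 0 - p 1 0)) +
    u * ((V 1 0)%:~R * (z 0 0 - p 0 0) + (V 1 1)%:~R * (z 1 0 - p 1 0)) +
    eigenform (A 1 0)%:~R u p (sV p).
  by rewrite -!affine_mapB /eigenform; ring.
have xV z : x (sV z) = al * x z + be * y z + x (sV p) by rewrite /x eigV xE.
have yV z : y (sV z) = ga * x z + de * y z + y (sV p) by rewrite /y eigV yE.
have sVp : sV p <> p.
  by move=> sVp; apply: sp; rewrite -{1}sVp /sV -affine_mapM mulgV affine_map1.
have xy0 : (x (sV p), al / ga * y (sV p)) != (0, 0).
  apply/eqP => -[x0 /eqP]; rewrite !mulf_eq0 invr_eq0 (negbTE al0) (negbTE ga0)/=.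
  move=> /eqP y0; apply: sVp.
  have w1 : sV p 1 0 - p 1 0 = 0.
    apply: (mulfI lm); rewrite mulr0 -[RHS](subrr 0) -{1}x0 -y0.
    by rewrite /x /y /eigenform; ring.
  have w0 : sV p 0 0 - p 0 0 = 0.
    by apply: (mulfI c0); rewrite mulr0 -[RHS]x0 /x /eigenform w1; ring.
  apply/matrixP => i j; rewrite ord1; move: i.
  by apply: forall_ord2; apply/eqP; rewrite -subr_eq0; apply/eqP.
have mx k c u : measurable_fun setT (fun z => k * eigenform c u p z).
  by apply: measurable_funM => //; exact: measurable_eigenform.
have mxV k c u : measurable_fun setT (fun z => k * eigenform c u p (sV z)).
  apply: measurable_funM => //; apply: measurableT_comp.
    exact: measurable_eigenform.
  exact: measurable_affine_map.
have L0 : 0 < l ^+ 10.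
  by apply: lt_le_trans qL; rewrite mulr_gt0 ?exprn_gt0//; lra.
have [s1 s2] : shrinking mu 4^-1 (l ^+ 10) (fun z => al * x z) (fun z => be * y z) /\
    shrinking mu 4^-1 (l ^+ 10) (fun z => be * y z) (fun z => al * x z).
  apply: (@almost_invariant_shrinking _ _ _ mu (affine_map (h ^+ 10)%g)) => //.
  - exact: mx.
  - exact: mx.
  - by move=> z; rewrite hx mulrCA.
  - by move=> z; rewrite hy mulrCA.
  - by apply: inv; left.
have [s3 s4] : shrinking mu 4^-1 (l ^+ 10)
      (fun z => 1 * x (sV z)) (fun z => al / ga * y (sV z)) /\
    shrinking mu 4^-1 (l ^+ 10)
      (fun z => al / ga * y (sV z)) (fun z => 1 * x (sV z)).
  apply: (@almost_invariant_shrinking _ _ _ mu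
    (affine_map (s * h ^+ 10 * s^-1)%g)) => //.
  - exact: mxV.
  - exact: mxV.
  - by move=> z; rewrite conj hx !mul1r.
  - by move=> z; rewrite conj hy mulrCA.
  - by apply: inv; right.
apply: (no_almost_invariant_mass mu1 _ _ _ _ q1 chi1 chi2 qL _ _ xy0 s1 s2 s3 s4).
- exact: mx.
- exact: mx.
- exact: mxV.
- exact: mxV.
- by move=> z; rewrite mul1r xV.
- by move=> z; rewrite yV; field; rewrite be0 ga0.
Qed.

Theorem corollary1p3 (R : realType) :
  exists N : nat, forall S : set SA2Z,
    finite_set S -> symmetric_set S -> S 1%g ->
    ~ virtually_solvable (generated S) ->
    ~ has_global_fixed_point (affine_action R) (generated S) ->
    (exists a b : SA2Z, [/\ set_power S N a, set_power S N b &
       nonamenable_for (affine_action R) [set a; b] (4^-1 : R)]) /\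
    uniformly_nonamenable R (affine_action R) (generated S).
Proof.
(* h^10 has length 40 in S, and its conjugate by s in S^2 has length 44. *)
exists 44.
have main (S : set SA2Z) : symmetric_set S -> S 1%g ->
    ~ virtually_solvable (generated S) ->
    ~ has_global_fixed_point (affine_action R) (generated S) ->
    exists a b : SA2Z, [/\ set_power S 44 a, set_power S 44 b &
       nonamenable_for (affine_action R) [set a; b] (4^-1 : R)].
  move=> symS S1 nvs nfix; have [h [Sh tr4]] := exists_hyperbolic symS S1 nvs.
  have [|p hp] := @affine_map_fixed_point R h.
    by apply: contraTneq tr4 => ->.
  have [s [Ss sp nt]] := exists_transverse p S1 nvs nfix (linear_part_det h) tr4.
  have SsV : set_power S 2 s^-1%g.
    exact: set_powerV.
  exists (h ^+ 10)%g, (s * h ^+ 10 * s^-1)%g; split.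
  - by apply: (@leq_set_power _ S 40 44) => //; exact: (@set_powerX _ S 4 10).
  - apply: (@set_powerM _ S 42 2) => //; apply: (@set_powerM _ S 2 40) => //.
    exact: (@set_powerX _ S 4 10).
  - exact: transverse_nonamenable tr4 hp sp nt.
move=> S _ symS S1 nvs nfix; split; first exact: main.
exists (4^-1 / 44%:R); split; first by rewrite divr_gt0.
move=> T _ TS; pose U : set SA2Z := [set 1%g] `|` (T `|` [set g^-1%g | g in T]).
have gU : generated U = generated S.
  rewrite -TS; apply/seteqP.
  split; apply: generated_sub; try exact: generated_subgroup.
    have sgT := generated_subgroup T.
    move=> g [->|[Tg|[k Tk <-]]].
    - exact: (subgroup1 sgT).
    - exact: sub_generated.
    - by apply: (subgroupV sgT); exact: sub_generated.
  by move=> g Tg; apply: sub_generated; right; left.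
have symU : symmetric_set U.
  have VU g : U g -> U g^-1%g.
    move=> [->|[Tg|[k Tk <-]]]; first by left; rewrite invg1.
      by right; right; exists g.
    by right; left; rewrite invgK.
  apply/seteqP; split=> [_ [g Ug <-]|g Ug]; first exact: VU.
  by exists g^-1%g; rewrite ?invgK//; exact: VU.
have [|||a [b [Ua Ub]]] := main U symU; rewrite ?gU//; first by left.
move=> /nonamenable_forP nab; apply/nonamenable_forP => mu mu1 invT.
apply: (nab mu mu1).
have invU g : U g -> almost_invariant mu (affine_action R g) (4^-1 / 44%:R).
  move=> [->|[Tg|[k Tk <-]]]; last by apply: almost_invariantV => //; exact: invT.
    move=> A mA; rewrite (_ : _ @^-1` A = A) ?subrr ?normr0 ?divr_ge0//.
    by apply/seteqP; split=> z; rewrite /= affine_map1.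
  exact: invT.
have E : 4^-1 / 44%:R *+ 44 = 4^-1 :> R by rewrite -mulr_natr divfK.
by move=> g [->|->]; rewrite -E; exact: almost_invariant_set_power invU _.
Qed.
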